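(* Let $\gamma:[0,1]\to\mathbb{R}^n$ be computable and such that $\Gamma=\gamma([0,1])$ is a simple rectifiable curve. Then $\mathcal{H}^1(\Gamma)$ is lower semicomputable.
   Context: A curve is simple if it is the range of a one-to-one continuous map from a compact interval, and rectifiable if it has finite length; $\mathcal{H}^1$ is one-dimensional Hausdorff measure (equal to length for simple curves). An oracle for a real $t$ is any $O_t:\mathbb{N}\to\mathbb{Q}$ with $|O_t(s)-t|\le2^{-s}$ for all $s$. A function $f:[0,1]\to\mathbb{R}^n$ is computable if there is an oracle Turing machine $M$ such that for every $t\in[0,1]$, $r\in\mathbb{N}$, and every oracle $O_t$ for $t$, $M^{O_t}(r)$ outputs a rational point within distance $2^{-r}$ of $f(t)$. A real number $x$ is lower semicomputable if there is a computable function $q:\mathbb{N}\to\mathbb{Q}$ with $q(r)\le x$ for all $r$ and $\sup_r q(r)=x$. *)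

(* Defs.v *)
From HB Require Import structures.
From mathcomp Require Import all_boot all_order all_algebra.
From mathcomp Require Import all_classical all_reals all_analysis.

Set Implicit Arguments.
Unset Strict Implicit.
Unset Printing Implicit Defensive.

Import Order.TTheory GRing.Theory Num.Theory.
Import numFieldNormedType.Exports.
Local Open Scope classical_set_scope.
Local Open Scope ring_scope.

(* Model of computation: oracle (mu-)recursive functions on nat.       *)
(* A program receives a list of nat arguments and may query an oracle *)
(* g : nat -> nat (rationals are encoded by nat through [pickle]).     *)
(* Oracle partial recursive functions are equivalent to oracle Turing  *)
(* machines.                                                            *)

Inductive prog : Type :=
| PZero
| PSucc
| PProj of nat
| POracle
| PComp of prog & list prog
| PRec of prog & prog
| PMu of prog.

Inductive peval (g : nat -> nat) : prog -> seq nat -> nat -> Prop :=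
| ev_zero xs : peval g PZero xs 0
| ev_succ xs : peval g PSucc xs (nth 0 xs 0).+1
| ev_proj i xs : peval g (PProj i) xs (nth 0 xs i)
| ev_oracle xs : peval g POracle xs (g (nth 0 xs 0))
| ev_comp f gs xs ys y :
    pevals g gs xs ys -> peval g f ys y -> peval g (PComp f gs) xs y
| ev_rec0 b s xs y :
    peval g b xs y -> peval g (PRec b s) (0%N :: xs) y
| ev_recS b s n xs z y :
    peval g (PRec b s) (n :: xs) z ->
    peval g s [:: n, z & xs] y ->
    peval g (PRec b s) (n.+1 :: xs) y
| ev_mu f xs y :
    peval g f (y :: xs) 0 ->
    (forall k, (k < y)%N -> exists v, v <> 0%N /\ peval g f (k :: xs) v) ->
    peval g (PMu f) xs y
with pevals (g : nat -> nat) : seq prog -> seq nat -> seq nat -> Prop :=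
| evs_nil xs : pevals g [::] xs [::]
| evs_cons p ps xs y ys :
    peval g p xs y -> pevals g ps xs ys -> pevals g (p :: ps) xs (y :: ys).

Definition computable_rat_seq (q : nat -> rat) : Prop :=
  exists M : prog, forall r : nat,
    peval (fun _ => 0%N) M [:: r] (pickle (q r)).

Definition enorm {R : realType} {n : nat} (x : 'rV[R]_n) : R :=
  Num.sqrt (\sum_(i < n) x ord0 i ^+ 2).

Definition is_oracle {R : realType} (t : R) (O : nat -> rat) : Prop :=
  forall s : nat, `|ratr (O s) - t| <= 2%:R ^- s.

Definition computable_fun {R : realType} {n : nat} (f : R -> 'rV[R]_n) : Prop :=
  exists M : prog, forall (t : R), 0 <= t <= 1 ->
    forall (O : nat -> rat), is_oracle t O ->
    forall r : nat, exists (out : nat) (v : 'rV[rat]_n),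
      [/\ peval (fun s => pickle (O s)) M [:: r] out,
          unpickle out = Some v &
          enorm (map_mx ratr v - f t) <= 2%:R ^- r].

Definition inscribed_length {R : realType} {n : nat}
  (g : R -> 'rV[R]_n) (s : seq R) : R :=
  \sum_(i < (size s).-1) enorm (g (nth 0 s i.+1) - g (nth 0 s i)).

Definition is_partition {R : realType} (a b : R) (s : seq R) : Prop :=
  [/\ (1 < size s)%N, head 0 s = a, last 0 s = b & sorted <%R s].

Definition curve_length {R : realType} {n : nat}
  (g : R -> 'rV[R]_n) (a b : R) : \bar R :=
  ereal_sup [set (inscribed_length g s)%:E | s in [set s | is_partition a b s]].

Definition simple_param {R : realType} {n : nat}
  (G : set 'rV[R]_n) (g : R -> 'rV[R]_n) (a b : R) : Prop :=
  [/\ a < b, {within `[a, b]%classic, continuous g},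
     {in `[a, b] &, injective g}
    & g @` `[a, b]%classic = G].

Definition simple_curve {R : realType} {n : nat} (G : set 'rV[R]_n) : Prop :=
  exists g a b, simple_param G g a b.

Definition simple_rectifiable_curve {R : realType} {n : nat}
  (G : set 'rV[R]_n) : Prop :=
  exists g a b, simple_param G g a b /\ (curve_length g a b < +oo)%E.

(* One-dimensional Hausdorff measure (normalized so that it equals     *)
(* length on segments): H^1(A) = sup_{d>0} H^1_d(A), where H^1_d(A) is *)
(* the infimum of sum diam(U_i) over countable covers with diam <= d.  *)

Definition diam {R : realType} {n : nat} (U : set 'rV[R]_n) : \bar R :=
  ereal_sup ([set (enorm (x - y))%:E | x in U & y in U] `|` [set 0%E]).

Definition hausdorff1_delta {R : realType} {n : nat}
  (d : R) (A : set 'rV[R]_n) : \bar R :=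
  ereal_inf [set (\sum_(0 <= i <oo) diam (U i))%E
            | U in [set U : nat -> set 'rV[R]_n |
                     A `<=` \bigcup_i U i /\ forall i, (diam (U i) <= d%:E)%E]].

Definition hausdorff1 {R : realType} {n : nat} (A : set 'rV[R]_n) : \bar R :=
  ereal_sup [set hausdorff1_delta d A | d in [set d : R | 0 < d]].

Definition lower_semicomputable {R : realType} (x : \bar R) : Prop :=
  exists q : nat -> rat, computable_rat_seq q /\
    (forall r, ((ratr (q r) : R)%:E <= x)%E) /\
    ereal_sup (range (fun r => (ratr (q r) : R)%:E)) = x.

(* Main.v *)
Require Import Defs.
From HB Require Import structures.
From mathcomp Require Import all_boot all_order all_algebra.
From mathcomp Require Import all_classical all_reals all_analysis.
From mathcomp Require Import lra ring zify.
Import Order.TTheory GRing.Theory Num.Theory.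
Import numFieldNormedType.Exports.
Local Open Scope classical_set_scope.
Local Open Scope ring_scope.

(* Let x_0, x_1, ... be the values of gamma at an enumeration of dyadic times.
   Then H^1(Gamma) = sup_N L_N, where L_N is the minimal length of a path through
   x_0, ..., x_(N-1), each visited at least once, with arbitrary jumps allowed.
   "L_N <= H^1": visit the points in the order of an injective parametrization;
   after shrinking each arc a little the arcs are at positive mutual distance, so
   for a fine cover the distances to the initial points of the arcs, laid end to
   end, map every covering set into a real interval of the same diameter, and
   Lebesgue measure is countably subadditive.
   "H^1 <= sup L_N": cut a shortest path into blocks of length delta; for N large
   the blocks, thickened by delta^2, are about L_N / delta sets that cover Gamma.
   The minimum over the finitely many paths is computable up to an error tending
   to 0, although gamma may retrace itself and no modulus of continuity is used;
   shifting by the error bound gives rational lower bounds. *)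

(** Two orders of the samples are useless here. The polygon through gamma in the order of time is
    too long wherever gamma runs back and forth, and nothing makes the order of an injective
    parametrization accessible to a program. Minimizing over all orders removes the choice from the
    computation; the injective order survives only in the correctness proof, as one competitor in
    the minimum.

    The radius delta^2 of the thickening is of smaller order than delta on purpose: there are about
    L_N / delta blocks, each of diameter enlarged by 2 delta^2, so the total cost is about 2 L_N
    delta and vanishes with delta.

    Density of the samples needs continuity of gamma, which is not a hypothesis: it comes from the
    fact that a halting computation reads finitely many oracle values. *)

Set Implicit Arguments.
Unset Strict Implicit.
Unset Printing Implicit Defensive.

(** * Oracle programs *)

Local Open Scope nat_scope.

(* The automatically generated scheme gives no induction hypothesis under the
   existential quantifier of [ev_mu]. *)
Lemma peval_mut (g : nat -> nat) (P : prog -> seq nat -> nat -> Prop)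
    (Q : seq prog -> seq nat -> seq nat -> Prop) :
  (forall xs, P PZero xs 0) ->
  (forall xs, P PSucc xs (nth 0 xs 0).+1) ->
  (forall i xs, P (PProj i) xs (nth 0 xs i)) ->
  (forall xs, P POracle xs (g (nth 0 xs 0))) ->
  (forall f gs xs ys y, Q gs xs ys -> P f ys y -> P (PComp f gs) xs y) ->
  (forall b s xs y, P b xs y -> P (PRec b s) (0 :: xs) y) ->
  (forall b s n xs z y, P (PRec b s) (n :: xs) z -> P s [:: n, z & xs] y ->
     P (PRec b s) (n.+1 :: xs) y) ->
  (forall f xs y, P f (y :: xs) 0 ->
     (forall k, k < y -> exists v, v <> 0 /\ P f (k :: xs) v) ->
     P (PMu f) xs y) ->
  (forall xs, Q [::] xs [::]) ->
  (forall p ps xs y ys, P p xs y -> Q ps xs ys -> Q (p :: ps) xs (y :: ys)) ->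
  forall p xs y, peval g p xs y -> P p xs y.
Proof.
move=> H1 H2 H3 H4 H5 H6 H7 H8 H9 H10.
exact: (fix F p xs y (H : peval g p xs y) {struct H} : P p xs y :=
  match H with
  | ev_zero xs => H1 xs
  | ev_succ xs => H2 xs
  | ev_proj i xs => H3 i xs
  | ev_oracle xs => H4 xs
  | ev_comp _ _ _ _ _ Hgs Hf => H5 _ _ _ _ _ (G _ _ _ Hgs) (F _ _ _ Hf)
  | ev_rec0 _ s _ _ Hb => H6 _ s _ _ (F _ _ _ Hb)
  | ev_recS _ _ _ _ _ _ Hz Hs => H7 _ _ _ _ _ _ (F _ _ _ Hz) (F _ _ _ Hs)
  | ev_mu f xs y H0 Hk => H8 f xs y (F _ _ _ H0) (fun k ky =>
      let: ex_intro v (conj v0 Hv) := Hk k ky in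
      ex_intro _ v (conj v0 (F _ _ _ Hv)))
  end
with G ps xs ys (H : pevals g ps xs ys) {struct H} : Q ps xs ys :=
  match H with
  | evs_nil xs => H9 xs
  | evs_cons _ _ _ _ _ Hp Hps => H10 _ _ _ _ _ (F _ _ _ Hp) (G _ _ _ Hps)
  end for F).
Qed.

Lemma peval_det g p xs y y' : peval g p xs y -> peval g p xs y' -> y = y'.
Proof.
move=> H; move: H y'; apply: (@peval_mut g (fun p xs y => forall y', peval g p xs y' -> y = y')
  (fun ps xs ys => forall ys', pevals g ps xs ys' -> ys = ys')).
- by move=> xs0 y' H; inversion H.
- by move=> xs0 y' H; inversion H.
- by move=> i xs0 y' H; inversion H.
- by move=> xs0 y' H; inversion H.
- move=> f gs xs0 ys y0 IHg IHf y' H; inversion H; subst.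
  apply: IHf; have E := IHg _ ltac:(eassumption); rewrite {1}E; eassumption.
- by move=> b s xs0 y0 IH y' H; inversion H; subst; apply: IH.
- move=> b s n xs0 z y0 IHz IHs y' H; inversion H; subst.
  apply: IHs; have E := IHz _ ltac:(eassumption); rewrite {1}E; eassumption.
- move=> f xs0 y0 IH0 IHk y' H; inversion H as [| | | | | | |? ? ? Hy Hlt]; subst.
  case: (ltngtP y0 y') => // lty.
    by have [v [v0 Hv]] := Hlt _ lty; case: v0; rewrite (IH0 _ Hv).
  by have [v [v0 Hv]] := IHk _ lty; case: v0; apply: Hv.
- by move=> xs0 ys' H; inversion H.
- move=> p0 ps xs0 y0 ys IHp IHps ys' H; inversion H; subst.
  by congr (_ :: _); [apply: IHp|apply: IHps].
Qed.

(** A halting run puts only finitely many questions to the oracle; [sample_dense] uses this in place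
    of continuity. For [PMu], the bounds of the finitely many runs below [y0] are combined by
    induction on [y0]. *)
Lemma finite_use g p xs y : peval g p xs y ->
  exists B, forall g', (forall i, i < B -> g' i = g i) -> peval g' p xs y.
Proof.
apply: (@peval_mut g (fun p xs y => exists B, forall g',
    (forall i, i < B -> g' i = g i) -> peval g' p xs y)
  (fun ps xs ys => exists B, forall g',
    (forall i, i < B -> g' i = g i) -> pevals g' ps xs ys)).
- by move=> xs0; exists 0 => g' _; constructor.
- by move=> xs0; exists 0 => g' _; constructor.
- by move=> i xs0; exists 0 => g' _; constructor.
- by move=> xs0; exists (nth 0 xs0 0).+1 => g' Hg; rewrite -Hg//; constructor.
- move=> f gs xs0 ys y0 [B1 H1] [B2 H2]; exists (maxn B1 B2) => g' Hg.
  by econstructor; [apply: H1|apply: H2] => i iB; apply: Hg; rewrite leq_max iB ?orbT.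
- by move=> b s xs0 y0 [B H]; exists B => g' Hg; constructor; apply: H.
- move=> b s n xs0 z y0 [B1 H1] [B2 H2]; exists (maxn B1 B2) => g' Hg.
  by econstructor; [apply: H1|apply: H2] => i iB; apply: Hg; rewrite leq_max iB ?orbT.
- move=> f xs0 y0 [B0 H0] Hk.
  have [B1 H1] : exists B, forall g', (forall i, i < B -> g' i = g i) ->
      forall k, k < y0 -> exists v, v <> 0 /\ peval g' f (k :: xs0) v.
    elim: {H0}y0 Hk => [|m IHm] Hk; first by exists 0.
    have [|B1 H1] := IHm; first by move=> k km; apply: Hk; apply: ltnW.
    have [v [v0 [B2 H2]]] := Hk m (ltnSn m).
    exists (maxn B1 B2) => g' Hg k; rewrite ltnS leq_eqVlt => /orP[/eqP ->|km].
      by exists v; split=> //; apply: H2 => i iB; apply: Hg; rewrite leq_max iB orbT.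
    by apply: H1 => // i iB; apply: Hg; rewrite leq_max iB.
  exists (maxn B0 B1) => g' Hg; constructor.
    by apply: H0 => i iB; apply: Hg; rewrite leq_max iB.
  by apply: H1 => i iB; apply: Hg; rewrite leq_max iB orbT.
- by move=> xs0; exists 0 => g' _; constructor.
- move=> p0 ps xs0 y0 ys [B1 H1] [B2 H2]; exists (maxn B1 B2) => g' Hg.
  by constructor; [apply: H1|apply: H2] => i iB; apply: Hg; rewrite leq_max iB ?orbT.
Qed.

(* A constant oracle becomes an extra last argument; [a] is the number of genuine
   arguments, which is known statically in every subprogram. *)
Fixpoint internalize_oracle (a : nat) (p : prog) : prog :=
  match p with
  | PZero => PZero
  | PSucc => if a is 0 then PComp PSucc [:: PZero] else PSucc
  | PProj i => if i < a then PProj i else PZero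
  | POracle => PProj a
  | PComp f gs => PComp (internalize_oracle (size gs) f)
      (rcons (map (fun q => internalize_oracle a q) gs) (PProj a))
  | PRec b s => PRec (internalize_oracle a.-1 b) (internalize_oracle a.+1 s)
  | PMu f => PMu (internalize_oracle a.+1 f)
  end.

Lemma pevals_rcons g ps xs ys p y :
  pevals g ps xs ys -> peval g p xs y -> pevals g (rcons ps p) xs (rcons ys y).
Proof.
move=> H Hp; elim: ps ys H => [|q ps IH] ys H; inversion H; subst => /=.
  by constructor=> //; constructor.
by constructor=> //; apply: IH.
Qed.

Lemma peval_internalize g c p xs y : peval (fun=> c) p xs y ->
  peval g (internalize_oracle (size xs) p) (rcons xs c) y.
Proof.
apply: (@peval_mut _ (fun p xs y =>
    peval g (internalize_oracle (size xs) p) (rcons xs c) y)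
  (fun ps xs ys => size ys = size ps /\
    pevals g (map (internalize_oracle (size xs)) ps) (rcons xs c) ys)).
- by move=> xs0; constructor.
(* On an empty list [PSucc] reads the default 0, but would read [c] once [c] is appended; hence its
   special translation. Out-of-range projections become [PZero] for the same reason. *)
- move=> [|x xs0] /=; last exact: (ev_succ g (x :: rcons xs0 c)).
  by econstructor; [constructor; constructor | exact: (ev_succ g [:: 0])].
- move=> i xs0 /=; case: ltnP => ix.
    by have := ev_proj g i (rcons xs0 c); rewrite nth_rcons ix.
  by rewrite nth_default//; constructor.
- move=> xs0 /=; have := ev_proj g (size xs0) (rcons xs0 c).
  by rewrite nth_rcons ltnn eqxx.
- move=> f gs xs0 ys y0 [sz Hg] Hf /=; econstructor; last by rewrite -sz; apply: Hf.
  apply: pevals_rcons => //.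
  by have := ev_proj g (size xs0) (rcons xs0 c); rewrite nth_rcons ltnn eqxx.
- by move=> b s xs0 y0 H /=; constructor.
- by move=> b s n xs0 z y0 H1 H2 /=; econstructor; [apply: H1|apply: H2].
- by move=> f xs0 y0 H0 Hk /=; constructor.
- by move=> xs0; split=> //; constructor.
- by move=> p0 ps xs0 y0 ys H [sz Hs]; split=> /=; [rewrite sz|constructor].
Qed.

(** * Closure properties of computable functions *)

Definition computable (k : nat) (f : seq nat -> nat) : Prop :=
  exists p, forall xs, size xs = k -> peval (fun=> 0) p xs (f xs).

Section Computable.
Variable k : nat.
Implicit Types (f h : seq nat -> nat) (b : seq nat -> bool).

Lemma comp_ext f f' :
  computable k f -> (forall xs, size xs = k -> f xs = f' xs) -> computable k f'.
Proof. by case=> p Hp E; exists p => xs sx; rewrite -E//; apply: Hp. Qed.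

Lemma comp_proj i : computable k (fun xs => nth 0 xs i).
Proof. by exists (PProj i) => xs _; constructor. Qed.

Lemma comp_subst F gs : computable (size gs) F ->
  (forall i, i < size gs -> computable k (nth (fun=> 0) gs i)) ->
  computable k (fun xs => F [seq g xs | g <- gs]).
Proof.
case=> p Hp Hgs.
have [ps Hps] : exists ps, forall xs, size xs = k ->
    pevals (fun=> 0) ps xs [seq g xs | g <- gs].
  elim: gs {Hp} Hgs => [|g gs IH] Hgs; first by exists [::] => xs _; constructor.
  have [ps Hps] := IH (fun i => Hgs i.+1).
  have [q Hq] := Hgs 0 isT.
  by exists (q :: ps) => xs sx /=; constructor; [apply: Hq|apply: Hps].
exists (PComp p ps) => xs sx; econstructor; first exact: Hps.
by apply: Hp; rewrite size_map.
Qed.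

Lemma comp_subst1 F f : computable 1 (fun xs => F (nth 0 xs 0)) -> computable k f ->
  computable k (fun xs => F (f xs)).
Proof.
move=> HF Hf; apply: (@comp_subst (fun ys => F (nth 0 ys 0)) [:: f]) => //.
by case.
Qed.

Lemma comp_subst2 F f h : computable 2 (fun xs => F (nth 0 xs 0) (nth 0 xs 1)) ->
  computable k f -> computable k h -> computable k (fun xs => F (f xs) (h xs)).
Proof.
move=> HF Hf Hh.
apply: (@comp_subst (fun ys => F (nth 0 ys 0) (nth 0 ys 1)) [:: f; h]) => //.
by case=> [|[]].
Qed.

Lemma comp_subst3 F f h l :
  computable 3 (fun xs => F (nth 0 xs 0) (nth 0 xs 1) (nth 0 xs 2)) ->
  computable k f -> computable k h -> computable k l -> computable k (fun xs => F (f xs) (h xs) (l xs)).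
Proof.
move=> HF Hf Hh Hl.
apply: (@comp_subst (fun ys => F (nth 0 ys 0) (nth 0 ys 1) (nth 0 ys 2))
  [:: f; h; l]) => //.
by case=> [|[|[]]].
Qed.

Lemma comp_succ f : computable k f -> computable k (fun xs => (f xs).+1).
Proof.
by apply: (@comp_subst1 succn); exists PSucc => xs _; constructor.
Qed.

Lemma comp_const c : computable k (fun=> c).
Proof.
elim: c => [|c IH]; first by exists PZero => xs _; constructor.
exact: (comp_succ IH).
Qed.

Lemma comp_rec f B S : computable k f -> computable k B -> computable k.+2 S ->
  computable k (fun xs => iteri (f xs) (fun i z => S [:: i, z & xs]) (B xs)).
Proof.
case=> pf Hf [pb Hb] [ps Hs].
(* [PRec] recurses on its first argument, so the program puts [f xs] in front and rebuilds all of
   [xs] behind it by projections. *)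
have Hall xs j : size xs = k -> pevals (fun=> 0)
    (map PProj (iota j (k - j))) xs (drop j xs).
  move=> sx; rewrite -sx; move E : (size xs - j) => d.
  elim: d j E => [|d IH] j E.
    rewrite drop_oversize; first by constructor.
    by rewrite -subn_eq0 E.
  have jx : j < size xs by rewrite -subn_gt0 E.
  rewrite (drop_nth 0)//=; constructor; first by constructor.
  by apply: IH; rewrite subnS E.
exists (PComp (PRec pb ps) (pf :: map PProj (iota 0 k))) => xs sx.
econstructor.
  constructor; first exact: Hf.
  by have := Hall xs 0 sx; rewrite subn0 drop0; apply.
elim: (f xs) => [|n IH] /=; first by constructor; apply: Hb.
by econstructor; [exact: IH | apply: Hs => /=; rewrite sx].
Qed.

Lemma comp_min b f : computable k.+1 (fun xs => b xs) ->
  (forall xs, size xs = k -> b (f xs :: xs) /\ forall y, y < f xs -> ~~ b (y :: xs)) ->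
  computable k f.
Proof.
move=> Hb H.
have [p Hp] : computable k.+1 (fun xs => ~~ b xs).
  have [p Hp] : computable 1 (fun xs => nat_of_bool (nth 0 xs 0 == 0)).
    exists (PComp (PRec (PComp PSucc [:: PZero]) PZero) [:: PProj 0]) => xs _.
    econstructor; first by repeat constructor.
    elim: (nth 0 xs 0) => [|m IH]; last by econstructor; [exact: IH|constructor].
    constructor; econstructor; first by repeat constructor.
    exact: (ev_succ _ [:: 0]).
  have [q Hq] := Hb.
  exists (PComp p [:: q]) => xs sx; econstructor.
    by constructor; [exact: Hq|constructor].
  by have := Hp [:: nat_of_bool (b xs)] erefl; rewrite /= eqb0.
exists (PMu p) => xs sx; have [H1 H2] := H xs sx; constructor.
  by have := Hp (f xs :: xs); rewrite H1 /= sx; apply.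
move=> y yf; exists 1; split=> //.
by have := Hp (y :: xs); rewrite (H2 _ yf) /= sx; apply.
Qed.

End Computable.

Lemma comp_add k f h : computable k f -> computable k h -> computable k (fun xs => f xs + h xs).
Proof.
move=> Hf Hh; apply: (comp_ext (comp_rec (S := fun ys => (nth 0 ys 1).+1) Hf Hh _)).
  exact/comp_succ/comp_proj.
by move=> xs _ /=; elim: (f xs) => //= m ->; rewrite addSn.
Qed.

Lemma comp_mul k f h : computable k f -> computable k h -> computable k (fun xs => f xs * h xs).
Proof.
apply: comp_subst2; apply: (comp_ext (comp_rec
  (S := fun ys => nth 0 ys 3 + nth 0 ys 1) (comp_proj 2 0) (comp_const 2 0) _)).
  by apply: comp_add; apply: comp_proj.
by move=> [|x [|y [|]]] //= _; elim: x => //= m ->; rewrite mulSn.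
Qed.

Lemma comp_exp k f h : computable k f -> computable k h -> computable k (fun xs => f xs ^ h xs).
Proof.
apply: comp_subst2; apply: (comp_ext (comp_rec
  (S := fun ys => nth 0 ys 2 * nth 0 ys 1) (comp_proj 2 1) (comp_const 2 1) _)).
  by apply: comp_mul; apply: comp_proj.
by move=> [|x [|y [|]]] //= _; elim: y => //= m ->; rewrite expnS.
Qed.

Lemma comp_sub k f h : computable k f -> computable k h -> computable k (fun xs => f xs - h xs).
Proof.
have Hp l g : computable l g -> computable l (fun xs => (g xs).-1).
  apply: comp_subst1; apply: (comp_ext (comp_rec
    (S := nth 0 ^~ 0) (comp_proj 1 0) (comp_const 1 0) _)); first exact: comp_proj.
  by move=> [|x [|]] //= _; case: x.
apply: comp_subst2; apply: (comp_ext (comp_rec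
  (S := fun ys => (nth 0 ys 1).-1) (comp_proj 2 1) (comp_proj 2 0) _)).
  exact/Hp/comp_proj.
by move=> [|x [|y [|]]] //= _; elim: y => //= [|m ->]; rewrite ?subn0 ?subnS.
Qed.

Lemma comp_sum k f h : computable k f -> computable k.+1 h ->
  computable k (fun xs => \sum_(i < f xs) h (nat_of_ord i :: xs)).
Proof.
move=> Hf Hh.
apply: (@comp_ext _ (fun xs => iteri (f xs) (fun i z => z + h (i :: xs)) 0)).
  (* The step function of [comp_rec] also receives the accumulator, which is removed from the
     arguments before [h] is called. *)
  pose S ys := nth 0 ys 1 + h (nth 0 ys 0 :: drop 2 ys).
  suff HS : computable k.+2 S.
    by apply: (comp_ext (comp_rec (S := S) Hf (comp_const _ 0) HS)) => xs _;
      rewrite /S /= drop0.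
  apply: comp_add; first exact: comp_proj.
  have := @comp_subst k.+2 h
    [seq (fun ys => nth 0 ys i) | i <- 0 :: iota 2 k].
  rewrite size_map /= size_iota => /(_ Hh) /=.
  have Hproj i : i < k.+1 -> computable k.+2
      (nth (fun=> 0) [seq (fun ys => nth 0 ys i) | i <- 0 :: iota 2 k] i).
    move=> ik; rewrite (nth_map 0) ?size_iota//=; last by rewrite size_iota.
    exact: comp_proj.
  move/(_ Hproj)/comp_ext; apply=> -[|x [|y xs]] //= [sx].
  rewrite drop0; congr (h (_ :: _)).
  rewrite -map_comp -[RHS](mkseq_nth 0) sx /mkseq (iotaDl 2 0) -map_comp.
  exact: eq_map.
by move=> xs _; elim: (f xs) => [|m IH] /=; rewrite ?big_ord0// IH big_ord_recr.
Qed.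

Section Predicates.
Variable k : nat.
Implicit Types (f h : seq nat -> nat) (b c : seq nat -> bool).

Lemma comp_neg b : computable k b -> computable k (fun xs => ~~ b xs).
Proof.
move=> Hb; apply: (comp_ext (comp_sub (comp_const k 1) Hb)) => xs _.
by case: (b xs).
Qed.

Lemma comp_and b c : computable k b -> computable k c -> computable k (fun xs => b xs && c xs).
Proof.
move=> Hb Hc; apply: (comp_ext (comp_mul Hb Hc)) => xs _.
by case: (b xs); case: (c xs).
Qed.

Lemma comp_or b c : computable k b -> computable k c -> computable k (fun xs => b xs || c xs).
Proof.
move=> Hb Hc; apply: (comp_ext (comp_neg (comp_and (comp_neg Hb) (comp_neg Hc)))).
by move=> xs _; rewrite negb_and !negbK.
Qed.

Lemma comp_leq f h : computable k f -> computable k h -> computable k (fun xs => f xs <= h xs).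
Proof.
move=> Hf Hh.
apply: (comp_ext (comp_sub (comp_const k 1) (comp_sub Hf Hh))) => xs _.
by rewrite /leq; case: (f xs - h xs).
Qed.

Lemma comp_eqn f h : computable k f -> computable k h -> computable k (fun xs => f xs == h xs).
Proof.
move=> Hf Hh; apply: (comp_ext (comp_and (comp_leq Hf Hh) (comp_leq Hh Hf))).
by move=> xs _; rewrite eqn_leq.
Qed.

Lemma comp_if b f h : computable k b -> computable k f -> computable k h ->
  computable k (fun xs => if b xs then f xs else h xs).
Proof.
move=> Hb Hf Hh; apply: (comp_ext (comp_add (comp_mul Hb Hf)
  (comp_mul (comp_neg Hb) Hh))) => xs _.
by case: (b xs); rewrite ?mul1n ?mul0n ?addn0.
Qed.

End Predicates.

Lemma comp_exists k f (b : seq nat -> bool) : computable k f -> computable k.+1 b ->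
  computable k (fun xs => [exists i : 'I_(f xs), b (nat_of_ord i :: xs)]).
Proof.
move=> Hf Hb.
apply: (comp_ext (comp_leq (comp_const k 1) (comp_sum Hf Hb))) => xs _.
congr nat_of_bool; rewrite lt0n sum_nat_eq0 negb_forall.
by apply: eq_existsb => i; rewrite eqb0 negbK.
Qed.

Lemma comp_forall k f (b : seq nat -> bool) : computable k f -> computable k.+1 b ->
  computable k (fun xs => [forall i : 'I_(f xs), b (nat_of_ord i :: xs)]).
Proof.
move=> Hf Hb; apply: (comp_ext (comp_neg (comp_exists Hf (comp_neg Hb)))) => xs _.
by rewrite negb_exists; congr nat_of_bool; apply: eq_forallb => i; exact: negbK.
Qed.

(** The quotient of [x] by [y] is the least [q] with [x < q.+1 * y]; for [y = 0] the first disjunct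
    stops the search at once, at the conventional value 0. *)
Lemma comp_div k f h : computable k f -> computable k h -> computable k (fun xs => f xs %/ h xs).
Proof.
apply: comp_subst2; apply: (@comp_min _ (fun ys =>
  (nth 0 ys 2 == 0) || ((nth 0 ys 1).+1 <= (nth 0 ys 0).+1 * nth 0 ys 2))).
  apply: comp_or; first by apply: comp_eqn; [exact: comp_proj|exact: comp_const].
  apply: comp_leq; first exact/comp_succ/comp_proj.
  by apply: comp_mul; [exact/comp_succ/comp_proj|exact: comp_proj].
move=> [|x [|y [|]]] //= _; case: y => [|y]; first by rewrite divn0.
rewrite [_.+1 == 0]/= !orFb; split=> [|q]; first exact: ltn_ceil.
by move=> qx; rewrite -leqNgt; apply: leq_trans (leq_divM x y.+1); rewrite leq_mul2r qx orbT.
Qed.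

Lemma comp_mod k f h : computable k f -> computable k h -> computable k (fun xs => f xs %% h xs).
Proof.
move=> Hf Hh.
apply: (comp_ext (comp_sub Hf (comp_mul (comp_div Hf Hh) Hh))) => xs _.
by rewrite {1}(divn_eq (f xs) (h xs)) addKn.
Qed.

(** * Arithmetic of coded lists *)

Definition hd n := head 0 (CodeSeq.decode n).
Definition tl n := CodeSeq.code (behead (CodeSeq.decode n)).

Lemma code_cons x s : CodeSeq.code (x :: s) = 2 ^ x * (CodeSeq.code s).*2.+1.
Proof. by []. Qed.

Lemma hd_code x s : hd (CodeSeq.code (x :: s)) = x.
Proof. by rewrite /hd CodeSeq.codeK. Qed.

Lemma tl_code x s : tl (CodeSeq.code (x :: s)) = CodeSeq.code s.
Proof. by rewrite /tl CodeSeq.codeK. Qed.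

(** By [code_cons] the head of a nonempty list is the 2-adic valuation of its code, so it is the
    least [v] for which [2 ^ v.+1] does not divide the code. The code 0 is the empty list, with
    default head 0. *)
Lemma comp_hd k f : computable k f -> computable k (fun xs => hd (f xs)).
Proof.
apply: comp_subst1; apply: (@comp_min _ (fun ys =>
  (nth 0 ys 1 == 0) || (nth 0 ys 1 %% 2 ^ (nth 0 ys 0).+1 != 0))).
  apply: comp_or; first by apply: comp_eqn; [exact: comp_proj|exact: comp_const].
  apply: comp_neg; apply: comp_eqn; last exact: comp_const.
  apply: comp_mod; first exact: comp_proj.
  by apply: comp_exp; [exact: comp_const|exact/comp_succ/comp_proj].
move=> [|n []] //= _; rewrite -[n]CodeSeq.decodeK.
case: (CodeSeq.decode n) => [|x s] //=.
rewrite -code_cons hd_code code_cons.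
have -> : (2 ^ x * (CodeSeq.code s).*2.+1 == 0) = false.
  by rewrite muln_eq0 expn_eq0.
split=> [|v vx] /=.
  by rewrite expnSr -muln_modr modn2 /= odd_double muln1 expn_eq0.
rewrite negbK; apply/eqP/eqP; rewrite -/(dvdn _ _).
by apply: dvdn_mulr; apply: dvdn_exp2l.
Qed.

Lemma comp_tl k f : computable k f -> computable k (fun xs => tl (f xs)).
Proof.
move=> Hf; apply: (@comp_ext _ (fun xs => f xs %/ 2 ^ hd (f xs) %/ 2)).
  apply: comp_div; last exact: comp_const.
  apply: comp_div => //.
  by apply: comp_exp; [exact: comp_const|exact: comp_hd].
move=> xs _; move: (f xs) => n; rewrite -[n]CodeSeq.decodeK.
case: (CodeSeq.decode n) => [|x s] //; rewrite hd_code tl_code code_cons.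
by rewrite mulKn ?expn_gt0// divn2 /= uphalf_double.
Qed.

Definition entry i n := nth 0 (CodeSeq.decode n) i.

Lemma comp_entry k f h : computable k f -> computable k h -> computable k (fun xs => entry (f xs) (h xs)).
Proof.
apply: comp_subst2; apply: (@comp_ext _ (fun xs =>
    hd (iteri (nth 0 xs 0) (fun _ => tl) (nth 0 xs 1)))).
  apply: comp_hd; apply: (comp_rec (S := fun ys => tl (nth 0 ys 1))).
  - exact: comp_proj.
  - exact: comp_proj.
  - exact/comp_tl/comp_proj.
move=> [|i [|n []]] //= _; rewrite /entry -[n]CodeSeq.decodeK.
move: (CodeSeq.decode n) => s; rewrite CodeSeq.codeK.
have -> : iteri i (fun=> tl) (CodeSeq.code s) = CodeSeq.code (drop i s).
  elim: i => [|i IH] /=; first by rewrite drop0.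
  by rewrite IH /tl CodeSeq.codeK -drop1 drop_drop.
by rewrite /hd CodeSeq.codeK -nth0 nth_drop addn0.
Qed.

(** * Decoding rational vectors *)

(** Only the empty list has code 0, so this tests for a list of exactly two entries, in a form
    visibly built from computable functions. *)
Definition pair_code e := (tl e != 0) && (tl (tl e) == 0).
Definition fst_code e := hd e.
Definition snd_code e := hd (tl e).

Lemma pair_codeE e : pair_code e = (size (CodeSeq.decode e) == 2).
Proof.
rewrite /pair_code -[e in LHS]CodeSeq.decodeK.
case: (CodeSeq.decode e) => [|x [|y [|z s]]] //; rewrite !tl_code //.
  by rewrite code_cons muln_eq0 expn_eq0.
by rewrite !code_cons !muln_eq0 !expn_eq0.
Qed.

Lemma decode_pair e : pair_code e ->
  CodeSeq.decode e = [:: fst_code e; snd_code e].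
Proof.
rewrite pair_codeE /fst_code /snd_code /tl /hd.
by case: (CodeSeq.decode e) => [|x [|y [|z s]]] // _; rewrite CodeSeq.codeK.
Qed.

Lemma unpickle_taggedE (T1 T2 : countType) e :
  @unpickle_tagged T1 (fun=> T2) e =
  if pair_code e then
    obind (fun i => omap (fun x => @Tagged T1 i (fun=> T2) x) (unpickle (snd_code e)))
      (unpickle (fst_code e))
  else None.
Proof.
rewrite /unpickle_tagged; case: ifPn => [/decode_pair ->//|].
by rewrite pair_codeE; case: (CodeSeq.decode e) => [|x [|y [|z s]]].
Qed.

Lemma unpickle_pairE (T1 T2 : countType) e : (unpickle e : option (T1 * T2)) =
  if pair_code e then
    obind (fun x => omap (pair x) (unpickle (snd_code e))) (unpickle (fst_code e))
  else None.
Proof.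
transitivity (omap (@pair_of_tag T1 T2) (@unpickle_tagged T1 (fun=> T2) e)).
  by [].
rewrite unpickle_taggedE; case: ifP => // _.
by case: (unpickle (fst_code e) : option T1) => //= x; case: (unpickle _).
Qed.

(** An integer is pickled as an element of [nat + nat], that is as a pair of options, and an option
    is read as the head of a list, with 0 for [None]. When both components are present,
    [sum_of_opair] prefers the second one, the negative case; so do the definitions below. *)
Definition int_code e := pair_code e && ((fst_code e != 0) || (snd_code e != 0)).
Definition int_of_code e : int :=
  if snd_code e != 0 then Negz (hd (snd_code e)) else Posz (hd (fst_code e)).
(** Programs handle naturals only, so an integer is carried as its positive and its negative
    part. *)
Definition posz_of_code e := if snd_code e != 0 then 0 else hd (fst_code e).
Definition negz_of_code e := if snd_code e != 0 then (hd (snd_code e)).+1 else 0.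

Lemma int_of_codeE e :
  int_of_code e = (Posz (posz_of_code e) - Posz (negz_of_code e))%R.
Proof.
rewrite /int_of_code /posz_of_code /negz_of_code; case: ifP => _.
  by rewrite NegzE sub0r.
by rewrite subr0.
Qed.

Lemma absz_of_code e : absz (int_of_code e) = posz_of_code e + negz_of_code e.
Proof.
rewrite /int_of_code /posz_of_code /negz_of_code; case: ifP => _ //=.
by rewrite addn0.
Qed.

Lemma unpickle_intE e : (unpickle e : option int) =
  if int_code e then Some (int_of_code e) else None.
Proof.
have unp x : (unpickle x : option (option nat)) =
    Some (if x == 0 then None else Some (hd x)).
  transitivity (Some (ohead (pmap (unpickle : nat -> option nat) (CodeSeq.decode x)))).
    by [].
  have -> s : pmap (unpickle : nat -> option nat) s = s by elim: s => //= a s ->.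
  rewrite -[x in x == 0]CodeSeq.decodeK /hd.
  by case: (CodeSeq.decode x) => //= a s; rewrite muln_eq0 expn_eq0.
transitivity (omap int_of_natsum (obind (@sum_of_opair nat nat)
  (unpickle e : option (option nat * option nat)))); first by [].
rewrite unpickle_pairE !unp /int_code /int_of_code; case: pair_code => //=.
rewrite /sum_of_opair /=.
by case: eqP => _; case: eqP => _.
Qed.

(** A bounded search for a common divisor, to which [comp_exists] applies; the bound [b] is large
    enough when [b] is positive. *)
Definition coprime_test a b :=
  ~~ [exists k : 'I_b.+1, (1 < k) && ((a %% k == 0) && (b %% k == 0))].

Lemma coprime_testE a b : 0 < b -> coprime_test a b = coprime a b.
Proof.
move=> b0; apply/idP/idP.
  apply: contraR; rewrite /coprime => g1; apply/existsP.
  have gb : gcdn a b < b.+1 by rewrite ltnS dvdn_leq// dvdn_gcdr.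
  exists (Ordinal gb) => /=; rewrite -!/(dvdn _ _) dvdn_gcdl dvdn_gcdr !andbT.
  by rewrite ltn_neqAle eq_sym g1 gcdn_gt0 b0 orbT.
move=> cab; rewrite /coprime_test; apply/existsP => -[k /and3P[k1 ka kb]].
have : k %| gcdn a b by rewrite dvdn_gcd; apply/andP; split.
by rewrite (eqP cab) dvdn1 => /eqP k1'; rewrite k1' in k1.
Qed.

(** The type [rat] consists of the pairs of integers with positive denominator and coprime entries;
    codes of other pairs do not decode. *)
Definition rat_code e :=
  [&& pair_code e, int_code (fst_code e), int_code (snd_code e),
      0 < posz_of_code (snd_code e) &
      coprime_test (posz_of_code (fst_code e) + negz_of_code (fst_code e))
        (posz_of_code (snd_code e))].

Lemma unpickle_ratP e :
  match (unpickle e : option rat) with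
  | Some q => [/\ rat_code e, numq q = int_of_code (fst_code e) &
                  denq q = Posz (posz_of_code (snd_code e))]
  | None => ~~ rat_code e
  end.
Proof.
rewrite (_ : (unpickle e : option rat) =
  obind insub (unpickle e : option (int * int)))//.
rewrite unpickle_pairE !unpickle_intE /rat_code.
case: pair_code => //=; case: int_code => //=; case: int_code => //=.
set a := fst_code e; set b := snd_code e.
have posb : (0 < int_of_code b)%R = (0 < posz_of_code b).
  by rewrite /int_of_code /posz_of_code; case: ifP.
have valb : (0 < posz_of_code b) -> int_of_code b = Posz (posz_of_code b).
  by rewrite /int_of_code /posz_of_code; case: ifP.
case: insubP => /= [q /andP[b0 cab] qE|].
  rewrite posb in b0; rewrite b0 /= coprime_testE// -absz_of_code; split.
  - by move: cab; rewrite valb.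
  - by rewrite /numq qE.
  - by rewrite /denq qE /= valb.
rewrite posb; case: (ltnP 0) => //= b0.
by rewrite coprime_testE// -absz_of_code valb.
Qed.

(* A matrix is pickled as the list of its entries tagged by their positions, and
   [unpickle] silently drops the undecodable items of a list: this is why the row
   entries below are located by their tag and rationality of codes is tested. *)
Lemma unpickle_rVE n out (v : 'rV[rat]_n) : unpickle out = Some v ->
  pmap (@unpickle_tagged ('I_1 * 'I_n)%type (fun=> rat)) (CodeSeq.decode out) =
  [seq @Tagged _ x (fun=> rat) (v x.1 x.2) | x : 'I_1 * 'I_n].
Proof.
rewrite (_ : unpickle out = obind insub (unpickle out : option {ffun 'I_1 * 'I_n -> rat}))//.
rewrite (_ : unpickle out = obind (@finfun.tfgraph_inv _ _) (obind insub
  (Some (pmap (@unpickle_tagged ('I_1 * 'I_n)%type (fun=> rat)) (CodeSeq.decode out)))))//.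
set s := pmap _ _.
rewrite [obind insub (Some s)]/=; case: insubP => //= G _ <-.
case E : (finfun.tfgraph_inv G) => [f|] //=.
rewrite insubT => -[<-].
have -> : G = tfgraph f; last by rewrite -codom_tffun; apply: eq_codom => -[i j].
apply: eq_from_tnth => i; rewrite -(enum_valK i); move: (enum_val i) => {i} x.
rewrite tnth_map -[tnth (enum_tuple _) _]enum_val_nth enum_rankK /total_fun.
(* Decoding the graph succeeds only if every position carries its own tag; this is [Dtg]. *)
move: E; rewrite /finfun.tfgraph_inv; case: eqfunP => // Dtg [<-].
rewrite ffunE; move: (Dtg x) => /=; case: (tnth G (enum_rank x)) => y q /= yx.
by case: x / yx.
Qed.

Lemma size_decode n : size (CodeSeq.decode n) <= n.
Proof.
rewrite -[n in _ <= n]CodeSeq.decodeK; elim: (CodeSeq.decode n) => //= x s IH.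
rewrite -[(size s).+1]mul1n leq_mul ?expn_gt0// ltnS -addnn.
exact: leq_trans IH (leq_addr _ _).
Qed.

(** This reads off the one entry marked by [P] by means of a sum, without a search. The code [n]
    itself bounds the length of the list, and positions past the end give the default 0, which [P]
    rejects. *)
Lemma sum_entry_unique (P : pred nat) n : ~~ P 0 ->
  count P (CodeSeq.decode n) = 1 ->
  exists2 e, P e /\ e \in CodeSeq.decode n & forall g : nat -> nat,
    \sum_(i < n) P (entry i n) * g (entry i n) = g e.
Proof.
move=> P0 cP.
have sF : size [seq e <- CodeSeq.decode n | P e] = 1 by rewrite size_filter.
case E : [seq e <- CodeSeq.decode n | P e] sF => [//|e [|//]] _; exists e.
  have : e \in [seq e <- CodeSeq.decode n | P e] by rewrite E mem_head.
  by rewrite mem_filter => /andP.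
move=> g; rewrite -(big_mkord xpredT (fun i => P (entry i n) * g (entry i n))).
rewrite (big_cat_nat _ (size_decode n))//= [X in _ + X]big1_seq ?addn0; last first.
  move=> i /=; rewrite mem_index_iota => /andP[si _].
  by rewrite /entry nth_default// (negPf P0).
transitivity (\sum_(e <- CodeSeq.decode n) P e * g e).
  by rewrite [RHS](big_nth 0).
transitivity (\sum_(e <- CodeSeq.decode n | P e) g e).
  by rewrite [RHS]big_mkcond; apply: eq_bigr => i _; case: (P i); rewrite ?mul1n.
by rewrite -big_filter E big_seq1.
Qed.

(** [CodeSeq.code [:: 0; j]] is the pickled position [(ord0, j)] of a row vector. *)
Definition sel_code j e := pair_code e &&
  ((fst_code e == CodeSeq.code [:: 0; j]) && rat_code (snd_code e)).

Lemma sel_codeE n (j : 'I_n) e : sel_code j e =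
  (omap (@tag _ _) (@unpickle_tagged ('I_1 * 'I_n)%type (fun=> rat) e)
    == Some (ord0, j)).
Proof.
rewrite unpickle_taggedE /sel_code; set K := CodeSeq.code _; case: pair_code => //=.
have := unpickle_ratP (snd_code e).
rewrite (unpickle_pairE 'I_1 'I_n).
case: unpickle => [q [-> _ _]|/negPf ->]; last first.
  by rewrite andbF; case: pair_code => //; case: (unpickle (fst_code (fst_code e)) : option 'I_1) => //= ?; case: unpickle.
rewrite andbT; set c := fst_code e.
have [pc|npc] := boolP (pair_code c); last first.
  by apply/negbTE; apply: contraNN npc => /eqP ->; rewrite pair_codeE /K CodeSeq.codeK.
rewrite /K -[c in c == _]CodeSeq.decodeK (decode_pair pc).
rewrite (can_eq CodeSeq.codeK) !eqseq_cons eqxx andbT.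
rewrite (_ : (unpickle (fst_code c) : option 'I_1) = insub (fst_code c))//.
rewrite (_ : (unpickle (snd_code c) : option 'I_n) = insub (snd_code c))//.
have [i _ iE|] := insubP 'I_n (snd_code c); last first.
  rewrite -leqNgt andbC => nj; case: (insub (fst_code c)) => [?|] /=;
  by apply/negbTE; apply/negP => /andP[/eqP jE]; have := ltn_ord j; rewrite -jE ltnNge nj.
rewrite -iE.
have [k _ kE|] := insubP 'I_1 (fst_code c); last by case: (fst_code c).
by rewrite -kE (ord1 k).
Qed.

(** Fixed-point arithmetic: the floor of [2 ^ P] times the positive or negative part (chosen by
    [part]) of coordinate [j], as a natural number. *)
Definition row_part (part : nat -> nat) P out j :=
  \sum_(l < out) sel_code j (entry l out) *
   (let r := snd_code (entry l out) in
    (part (fst_code r) * 2 ^ P) %/ posz_of_code (snd_code r)).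

(** Each of the two floors loses less than 1, and the losses enter the difference with opposite
    signs, so they do not add up. *)
Lemma row_partP n out (v : 'rV[rat]_n) P (j : 'I_n) : unpickle out = Some v ->
  (`|(row_part posz_of_code P out j)%:R - (row_part negz_of_code P out j)%:R
    - 2 ^+ P * v ord0 j| <= 1 :> rat)%R.
Proof.
move=> /unpickle_rVE vE.
(* Since the row does decode, every position occurs exactly once among the decodable entries. *)
have cnt : count (sel_code j) (CodeSeq.decode out) = 1.
  transitivity (count_mem (ord0, j) [seq tag w | w <- pmap
      (@unpickle_tagged ('I_1 * 'I_n)%type (fun=> rat)) (CodeSeq.decode out)]).
    elim: (CodeSeq.decode out) => //= e s ->; rewrite sel_codeE.
    by case: unpickle_tagged.
  rewrite vE -map_comp map_id_in//; rewrite count_uniq_mem ?enum_uniq//.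
  by rewrite mem_enum.
have s0 : ~~ sel_code j 0 by [].
have [e [se es] sumE] := sum_entry_unique s0 cnt.
rewrite /row_part (sumE (fun e => let r := snd_code e in
  (posz_of_code (fst_code r) * 2 ^ P) %/ posz_of_code (snd_code r))).
rewrite (sumE (fun e => let r := snd_code e in
  (negz_of_code (fst_code r) * 2 ^ P) %/ posz_of_code (snd_code r))) /=.
have : unpickle (snd_code e) = Some (v ord0 j).
  move: (se); rewrite sel_codeE => /eqP.
  case E : (@unpickle_tagged ('I_1 * 'I_n)%type (fun=> rat) e) => [w|] //= [wj].
  have : w \in pmap (@unpickle_tagged ('I_1 * 'I_n)%type (fun=> rat))
      (CodeSeq.decode out) by rewrite mem_pmap; apply/mapP; exists e.
  rewrite vE => /mapP[x _ wE]; move: wj; rewrite wE /= => xj; move: E.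
  rewrite unpickle_taggedE wE xj; case: pair_code => //.
  case: (unpickle (snd_code e)) => [q|]; last by case: unpickle.
  by case: unpickle => //= y H; have /= -> := congr1 (oapp (fun w : {_ : 'I_1 * 'I_n & rat} => tagged w) 0%R) H.
have := unpickle_ratP (snd_code e) => /[swap] ->.
set a := fst_code (snd_code e); set b := snd_code (snd_code e); move=> [/and5P[_ _ _ b0 _] qa qb].
rewrite -(divq_num_den (v ord0 j)) qa qb int_of_codeE rmorphB /= -!pmulrn.
set d := posz_of_code b in b0 *.
have fl m : (((m * 2 ^ P) %/ d)%:R <= 2 ^+ P * (m%:R / d%:R : rat) <
    ((m * 2 ^ P) %/ d)%:R + 1)%R.
  rewrite mulrA -natrX -natrM ler_pdivlMr ?ltr0n// ltr_pdivrMr ?ltr0n//.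
  rewrite natr1 -!natrM ler_nat ltr_nat (mulnC (2 ^ P)) leq_divM /=.
  exact: ltn_ceil.
rewrite mulrBl mulrBr.
have /andP[] := fl (posz_of_code a); have /andP[] := fl (negz_of_code a).
move=> *; rewrite ler_norml; apply/andP; split; lra.
Qed.

(** * Shortest tours *)

Ltac comp_base := lazymatch goal with
  | |- computable _ (fun=> ?c) => apply: comp_const
  | |- computable _ (fun xs => nth 0 xs _) => apply: comp_proj
  | |- computable _ (fun xs => if _ then _ else _) => apply: comp_if
  | |- computable _ (fun xs => S _) => apply: comp_succ
  | |- computable _ (fun xs => addn _ _) => apply: comp_add
  | |- computable _ (fun xs => subn _ _) => apply: comp_sub
  | |- computable _ (fun xs => muln _ _) => apply: comp_mul
  | |- computable _ (fun xs => expn _ _) => apply: comp_exp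
  | |- computable _ (fun xs => divn _ _) => apply: comp_div
  | |- computable _ (fun xs => modn _ _) => apply: comp_mod
  | |- computable _ (fun xs => nat_of_bool (negb _)) => apply: comp_neg
  | |- computable _ (fun xs => nat_of_bool (andb _ _)) => apply: comp_and
  | |- computable _ (fun xs => nat_of_bool (orb _ _)) => apply: comp_or
  | |- computable _ (fun xs => nat_of_bool (leq _ _)) => apply: comp_leq
  | |- computable _ (fun xs => nat_of_bool (eq_op _ _)) => apply: comp_eqn
  | |- computable _ (fun xs => entry _ _) => apply: comp_entry
  | |- computable _ (fun xs => hd _) => apply: comp_hd
  | |- computable _ (fun xs => tl _) => apply: comp_tl
  | |- _ => assumption
  end.

Lemma comp_pair_code k f : computable k f -> computable k (fun xs => pair_code (f xs)).
Proof. by move=> Hf; rewrite /pair_code; repeat comp_base. Qed.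

Lemma comp_posz k f : computable k f -> computable k (fun xs => posz_of_code (f xs)).
Proof. by move=> Hf; rewrite /posz_of_code /fst_code /snd_code; repeat comp_base. Qed.

Lemma comp_negz k f : computable k f -> computable k (fun xs => negz_of_code (f xs)).
Proof. by move=> Hf; rewrite /negz_of_code /fst_code /snd_code; repeat comp_base. Qed.

Ltac comp_codes := lazymatch goal with
  | |- computable _ (fun xs => nat_of_bool (pair_code _)) => apply: comp_pair_code
  | |- computable _ (fun xs => posz_of_code _) => apply: comp_posz
  | |- computable _ (fun xs => negz_of_code _) => apply: comp_negz
  | |- _ => comp_base
  end.

Lemma comp_coprime_test k f h : computable k f -> computable k h ->
  computable k (fun xs => coprime_test (f xs) (h xs)).
Proof.
apply: (comp_subst2 (F := fun a b => nat_of_bool (coprime_test a b))); apply: comp_neg.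
apply: (@comp_exists 2 (fun xs => (nth 0 xs 1).+1) (fun ys => (1 < nth 0 ys 0) &&
  ((nth 0 ys 1 %% nth 0 ys 0 == 0) && (nth 0 ys 2 %% nth 0 ys 0 == 0)))).
  by repeat comp_base.
by repeat comp_base.
Qed.

Lemma comp_rat_code k f : computable k f -> computable k (fun xs => rat_code (f xs)).
Proof.
move=> Hf; rewrite /rat_code /int_code /fst_code /snd_code.
repeat comp_codes; apply: comp_coprime_test; repeat comp_codes.
Qed.

Lemma comp_sel_code k f h : computable k f -> computable k h ->
  computable k (fun xs => sel_code (f xs) (h xs)).
Proof.
move=> Hf Hh; apply: (@comp_ext _ (fun xs => pair_code (h xs) &&
    ((hd (h xs) == (2 ^ f xs * 2).+1) && rat_code (hd (tl (h xs)))))).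
  by repeat comp_codes; apply: comp_rat_code; repeat comp_codes.
move=> xs _; rewrite /sel_code /fst_code /snd_code.
suff -> : CodeSeq.code [:: 0; f xs] = (2 ^ f xs * 2).+1 by [].
by rewrite /CodeSeq.code /= mul1n muln1 -muln2.
Qed.

Lemma comp_row_part k part f g h :
  (forall l u, computable l u -> computable l (fun xs => part (u xs))) ->
  computable k f -> computable k g -> computable k h ->
  computable k (fun xs => row_part part (f xs) (g xs) (h xs)).
Proof.
move=> Hpart; apply: (comp_subst3 (F := row_part part)).
apply: (@comp_sum 3 (nth 0 ^~ 1) (fun ys => sel_code (nth 0 ys 3)
    (entry (nth 0 ys 0) (nth 0 ys 2)) *
   (let r := snd_code (entry (nth 0 ys 0) (nth 0 ys 2)) in
    (part (fst_code r) * 2 ^ nth 0 ys 1) %/ posz_of_code (snd_code r)))).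
  exact: comp_proj.
rewrite /fst_code /snd_code /=.
repeat comp_codes; first by apply: comp_sel_code; repeat comp_codes.
by apply: Hpart; repeat comp_codes.
Qed.

Definition absdiff a b := (a - b) + (b - a).
Definition isqrt m := find (fun y => m < y.+1 ^ 2) (iota 0 m.+1).

Lemma isqrtP m : isqrt m ^ 2 <= m < (isqrt m).+1 ^ 2.
Proof.
have hasm : has (fun y => m < y.+1 ^ 2) (iota 0 m.+1).
  apply/hasP; exists m; first by rewrite mem_iota ltnSn.
  by rewrite expnS expn1 leq_pmulr.
have := nth_find 0 hasm; rewrite has_find size_iota in hasm.
rewrite nth_iota// add0n -/(isqrt m) => ->; rewrite andbT.
rewrite leqNgt; apply/negP => lt; case E : (isqrt m) lt => [|y] // lt.
have yE : y < find (fun y => m < y.+1 ^ 2) (iota 0 m.+1) by rewrite -/(isqrt m) E.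
have := before_find 0 yE; rewrite nth_iota ?add0n ?lt//.
exact: ltn_trans yE hasm.
Qed.

Lemma comp_isqrt k f : computable k f -> computable k (fun xs => isqrt (f xs)).
Proof.
apply: comp_subst1; apply: (@comp_min _ (fun ys =>
  (nth 0 ys 1).+1 <= (nth 0 ys 0).+1 ^ 2)); first by repeat comp_base.
move=> [|m []] //= _; have /andP[H1 H2] := isqrtP m; split=> // y ym.
rewrite -leqNgt; apply: leq_trans H1; by rewrite leq_exp2r.
Qed.

(* Index sequences of length [N] are coded by their base-[N] digits. *)
Definition digit s b i := (s %/ b ^ i) %% b.

Lemma digits_exist b m (sigma : nat -> nat) : (forall i, i < m -> sigma i < b) ->
  exists2 s, s < b ^ m & forall i, i < m -> digit s b i = sigma i.
Proof.
elim: m sigma => [|m IH] sigma lt; first by exists 0.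
have [|s sb Hs] := IH (fun i => sigma i.+1); first by move=> i im; apply: lt.
have s0 := lt 0 isT.
exists (s * b + sigma 0) => [|[|i] im].
- rewrite expnSr; apply: (@leq_trans (s.+1 * b)); last by rewrite leq_mul2r sb orbT.
  by rewrite mulSn addnC ltn_add2r.
- by rewrite /digit expn0 divn1 modnMDl modn_small.
- rewrite -Hs// /digit expnS divnMA divnMDl  ?(divn_small s0) ?addn0//.
  exact: leq_ltn_trans (leq0n _) s0.
Qed.

Section Tours.
Variable D : nat -> nat -> nat -> nat.

Definition tour_length N s :=
  \sum_(i < N.-1) D N (digit s N i) (digit s N i.+1).
Definition tour N s := [forall j : 'I_N, [exists i : 'I_N, digit s N i == j]].
(** Phrased as a decidable condition on the bound [z], so that the minimum becomes a search covered
    by [comp_min]. *)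
Definition has_tour N z :=
  [exists s : 'I_(N ^ N), tour N s && (tour_length N s <= z)].

Lemma has_tourP N (sigma : nat -> nat) :
  (forall i, i < N -> sigma i < N) ->
  (forall j, j < N -> exists2 i, i < N & sigma i = j) ->
  has_tour N (\sum_(i < N.-1) D N (sigma i) (sigma i.+1)).
Proof.
move=> lt surj; have [s sN sE] := digits_exist lt.
apply/existsP; exists (Ordinal sN) => /=; apply/andP; split.
  apply/forallP => j; have [i iN ij] := surj j (ltn_ord j).
  by apply/existsP; exists (Ordinal iN); rewrite /= sE// ij.
apply: leq_sum => i _; rewrite !sE//.
  by case: (N) i => [|N'] [].
by case: (N) i => [|N'] [] //= i /ltnW.
Qed.

Lemma has_tour_exists N : exists z, has_tour N z.
Proof.
exists (\sum_(i < N.-1) D N i i.+1); apply: (@has_tourP _ id) => // j jN.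
by exists j.
Qed.

Definition shortest_tour N := ex_minn (has_tour_exists N).

Lemma shortest_tour_le N (sigma : nat -> nat) :
  (forall i, i < N -> sigma i < N) ->
  (forall j, j < N -> exists2 i, i < N & sigma i = j) ->
  shortest_tour N <= \sum_(i < N.-1) D N (sigma i) (sigma i.+1).
Proof.
by rewrite /shortest_tour => lt surj; case: ex_minnP => m _; apply; apply: has_tourP.
Qed.

Lemma shortest_tour_attained N : 0 < N -> exists sigma : nat -> nat,
  [/\ forall i, sigma i < N,
      forall j, j < N -> exists2 i, i < N & sigma i = j &
      \sum_(i < N.-1) D N (sigma i) (sigma i.+1) <= shortest_tour N].
Proof.
rewrite /shortest_tour => N0; case: ex_minnP => m /existsP[s /andP[ts ls]] _.
exists (digit s N); split=> // [i|j jN]; first by rewrite ltn_mod.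
have /existsP[i /eqP ij] := forallP ts (Ordinal jN).
by exists i.
Qed.

Lemma comp_shortest_tour :
  computable 3 (fun xs => D (nth 0 xs 0) (nth 0 xs 1) (nth 0 xs 2)) ->
  forall k f, computable k f -> computable k (fun xs => shortest_tour (f xs)).
Proof.
move=> HD k f; apply: comp_subst1.
apply: (@comp_min _ (fun ys => has_tour (nth 0 ys 1) (nth 0 ys 0))); last first.
  move=> [|N []] //= _; rewrite /shortest_tour; case: ex_minnP => m Hm Hmin.
  by split=> // y ym; apply/negP => /Hmin; rewrite leqNgt ym.
apply: (@comp_exists 2 (fun xs => nth 0 xs 1 ^ nth 0 xs 1)
  (fun ys => tour (nth 0 ys 2) (nth 0 ys 0) &&
     (tour_length (nth 0 ys 2) (nth 0 ys 0) <= nth 0 ys 1))).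
  by repeat comp_base.
apply: comp_and.
  apply: (@comp_forall 3 (nth 0 ^~ 2) (fun ys =>
    [exists i : 'I_(nth 0 ys 3), digit (nth 0 ys 1) (nth 0 ys 3) i == nth 0 ys 0])).
    by repeat comp_base.
  apply: (@comp_exists 4 (nth 0 ^~ 3) (fun ys =>
    digit (nth 0 ys 2) (nth 0 ys 4) (nth 0 ys 0) == nth 0 ys 1)).
    by repeat comp_base.
  by rewrite /digit; repeat comp_base.
apply: comp_leq; last exact: comp_proj.
apply: (@comp_ext _ (fun xs => \sum_(i < nth 0 xs 2 - 1)
   D (nth 0 xs 2) (digit (nth 0 xs 0) (nth 0 xs 2) i)
     (digit (nth 0 xs 0) (nth 0 xs 2) i.+1))).
  apply: (@comp_sum 3 (fun xs => nth 0 xs 2 - 1) (fun ys =>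
   D (nth 0 ys 3) (digit (nth 0 ys 1) (nth 0 ys 3) (nth 0 ys 0))
     (digit (nth 0 ys 1) (nth 0 ys 3) (nth 0 ys 0).+1))).
    by repeat comp_base.
  by apply: (comp_subst3 HD); rewrite /digit; repeat comp_base.
by move=> xs _; rewrite /tour_length subn1.
Qed.

End Tours.

Local Open Scope ring_scope.

(** * The Euclidean norm *)

Section EuclideanNorm.
Variables (R : realType) (n : nat).
Implicit Types x y z : 'rV[R]_n.

Lemma enorm_ge0 x : 0 <= enorm x.
Proof. exact: sqrtr_ge0. Qed.

Lemma enorm0 : enorm (0 : 'rV[R]_n) = 0.
Proof.
by rewrite /enorm big1 ?sqrtr0// => i _; rewrite mxE expr0n.
Qed.

Lemma enormN x : enorm (- x) = enorm x.
Proof. by rewrite /enorm; congr Num.sqrt; apply: eq_bigr => i _; rewrite mxE sqrrN. Qed.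

Lemma enormB x y : enorm (x - y) = enorm (y - x).
Proof. by rewrite -enormN opprB. Qed.

Lemma ler_enormD x y : enorm (x + y) <= enorm x + enorm y.
Proof.
pose a i := x ord0 i; pose b i := y ord0 i.
have sq_ge0 (u : 'I_n -> R) : 0 <= \sum_(i < n) u i ^+ 2.
  by apply: sumr_ge0 => i _; apply: sqr_ge0.
have CS : (\sum_(i < n) a i * b i) ^+ 2 <=
    (\sum_(i < n) a i ^+ 2) * (\sum_(i < n) b i ^+ 2).
  have E1 : (\sum_(i < n) a i * b i) ^+ 2 =
      \sum_(i < n) \sum_(j < n) (a i * b i) * (a j * b j).
    by rewrite expr2 mulr_suml; apply: eq_bigr => i _; rewrite mulr_sumr.
  have E2 : (\sum_(i < n) a i ^+ 2) * (\sum_(i < n) b i ^+ 2) =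
      \sum_(i < n) \sum_(j < n) a i ^+ 2 * b j ^+ 2.
    by rewrite mulr_suml; apply: eq_bigr => i _; rewrite mulr_sumr.
  have E3 : (\sum_(i < n) a i ^+ 2) * (\sum_(i < n) b i ^+ 2) =
      \sum_(i < n) \sum_(j < n) a j ^+ 2 * b i ^+ 2.
    by rewrite E2 exchange_big.
  (* Doubling allows the product of sums to be symmetrized in [i] and [j]; the difference is then
     the sum of the squares of [a i * b j - a j * b i]. *)
  suff : (\sum_(i < n) a i * b i) ^+ 2 *+ 2 <= ((\sum_(i < n) a i ^+ 2) * (\sum_(i < n) b i ^+ 2)) *+ 2.
    by rewrite !mulr2n; lra.
  rewrite [leRHS]mulr2n {1}E2 E3 E1 -big_split -sumrMnl /=.
  apply: ler_sum => i _; rewrite -big_split -sumrMnl /=; apply: ler_sum => j _.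
  by have := sqr_ge0 (a i * b j - a j * b i); rewrite mulr2n; nra.
rewrite -(@ler_pXn2r _ 2) ?nnegrE ?addr_ge0 ?enorm_ge0//.
rewrite sqrrD !sqr_sqrtr ?sq_ge0//.
have -> : \sum_(i < n) (x + y) ord0 i ^+ 2 = \sum_(i < n) a i ^+ 2 +
    (\sum_(i < n) a i * b i) *+ 2 + \sum_(i < n) b i ^+ 2.
  rewrite -sumrMnl -!big_split /=; apply: eq_bigr => i _.
  by rewrite mxE sqrrD.
rewrite lerD2r lerD2l lerMn2r /= -sqrtrM ?sq_ge0//.
apply: le_trans (ler_norm _) _; rewrite -sqrtr_sqr.
by rewrite ler_wsqrtr.
Qed.

Lemma enorm_triangle y x z : enorm (x - z) <= enorm (x - y) + enorm (y - z).
Proof. by apply: le_trans (ler_enormD _ _); rewrite addrA subrK. Qed.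

Lemma ler_dist_enorm x y : `|enorm x - enorm y| <= enorm (x - y).
Proof.
rewrite ler_norml; have := ler_enormD (x - y) y; have := ler_enormD (y - x) x.
by rewrite !subrK (enormB y) => *; apply/andP; split; lra.
Qed.

Lemma coord_le_enorm x i : `|x ord0 i| <= enorm x.
Proof.
rewrite -sqrtr_sqr ler_wsqrtr// (bigD1 i)//= lerDl.
by apply: sumr_ge0 => j _; apply: sqr_ge0.
Qed.

Lemma enorm_le_sum x : enorm x <= \sum_(i < n) `|x ord0 i|.
Proof.
have s0 : 0 <= \sum_(i < n) `|x ord0 i| by apply: sumr_ge0.
rewrite -(ger0_norm s0) -sqrtr_sqr ler_wsqrtr//.
elim: (index_enum _) => [|i r IH]; first by rewrite !big_nil expr0n.
rewrite !big_cons sqrrD -normrX ger0_norm ?sqr_ge0// -addrA lerD2l.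
apply: le_trans IH _; rewrite lerDr mulrn_wge0// mulr_ge0// sumr_ge0//.
Qed.

Lemma enormZ c x : enorm (c *: x) = `|c| * enorm x.
Proof.
rewrite /enorm -sqrtr_sqr -sqrtrM ?sqr_ge0// mulr_sumr; congr Num.sqrt.
by apply: eq_bigr => i _; rewrite mxE exprMn.
Qed.

Lemma enorm_eq0 x : enorm x = 0 -> x = 0.
Proof.
move=> x0; apply/rowP => i; rewrite mxE; apply/eqP; rewrite -normr_le0 -x0.
exact: coord_le_enorm.
Qed.

Lemma continuous_enorm : continuous (@enorm R n).
Proof.
move=> x; apply: continuous_comp; last exact: sqrt_continuous.
apply: cvg_big => [||i _]; [exact: add_continuous|exact: nbhs_filter|].
have := continuous_comp (@coord_continuous R 1 n ord0 i x) (@exprn_continuous R 2 _).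
exact.
Qed.

End EuclideanNorm.

(** * Samples of a computable curve *)

Definition dyadic (k m : nat) : rat := (k.*2.+1)%:R / 2%:R ^+ m.

(** A natural [p], seen as an integer, is pickled as the pair ([Some p], [None]): [2 ^ p] codes the
    list with the single entry [p], and 0 codes the empty list. *)
Definition dyadic_code (k m : nat) : nat :=
  CodeSeq.code [:: CodeSeq.code [:: 2 ^ k.*2.+1; 0]; CodeSeq.code [:: 2 ^ (2 ^ m); 0]]%N.

(* An odd numerator makes the fraction reduced, so that [pickle] sees it as it is. *)
Lemma pickle_dyadic k m : pickle (dyadic k m) = dyadic_code k m.
Proof.
have pP (p : nat) : pickle (Posz p) = CodeSeq.code [:: 2 ^ p; 0]%N.
  by rewrite -[(2 ^ p)%N]muln1.
have cop : coprime `|Posz k.*2.+1| `|Posz (2 ^ m)%N|.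
  by rewrite /= coprimeXr// coprimen2 /= odd_double.
have E : dyadic k m = (Posz k.*2.+1)%:~R / (Posz (2 ^ m)%N)%:~R.
  by rewrite /dyadic -!pmulrn natrX.
rewrite (_ : pickle (dyadic k m) = CodeSeq.code
  [:: pickle (numq (dyadic k m)); pickle (denq (dyadic k m))])// E.
rewrite coprimeq_num// coprimeq_den// eqz_nat expn_eq0 /= gtr0_sg ?mul1r; last first.
  by rewrite ltz_nat expn_gt0.
by rewrite -[`|_|%R]/(Posz (2 ^ m)%N) !pP.
Qed.

Lemma comp_dyadic_code k f h : computable k f -> computable k h ->
  computable k (fun xs => dyadic_code (f xs) (h xs)).
Proof.
move=> Hf Hh; rewrite /dyadic_code /CodeSeq.code /=.
apply: (@comp_ext _ (fun xs =>
  2 ^ (2 ^ (2 ^ (f xs * 2).+1) * 3) * (2 ^ (2 ^ (2 ^ (2 ^ h xs)) * 3) * 2).+1)%N).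
  by repeat comp_base.
by move=> xs _; rewrite expn0 !muln1 -!muln2.
Qed.

(* [i.+1] codes a nonempty list, so (hd i.+1, tl i.+1) ranges over all pairs. *)
Definition time (i : nat) : rat :=
  if ((tl i.+1).*2.+1 <= 2 ^ hd i.+1)%N then dyadic (tl i.+1) (hd i.+1) else 0.

Lemma comp_pickle_time k f : computable k f ->
  computable k (fun xs => pickle (time (f xs))).
Proof.
move=> Hf; apply: (@comp_ext _ (fun xs =>
   if ((tl (f xs).+1 * 2).+1 <= 2 ^ hd (f xs).+1)%N
   then dyadic_code (tl (f xs).+1) (hd (f xs).+1) else pickle (0 : rat))).
  by repeat comp_base; apply: comp_dyadic_code; repeat comp_base.
by move=> xs _; rewrite /time -muln2; case: ifP => // _; rewrite pickle_dyadic.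
Qed.

Lemma dyadic_ge0 k m : 0 <= dyadic k m.
Proof. by rewrite divr_ge0// exprn_ge0. Qed.

Section Times.
Variable R : realType.

Lemma time01 i : 0 <= (ratr (time i) : R) <= 1.
Proof.
rewrite -(rmorph1 (@ratr R)) ler0q ler_rat /time; case: ifP => [le|_]; last by rewrite lexx ler01.
rewrite dyadic_ge0 /dyadic ler_pdivrMr ?exprn_gt0// mul1r -natrX ler_nat.
exact: le.
Qed.

Lemma time_dense (t e : R) : 0 <= t <= 1 -> 0 < e ->
  exists i, `|ratr (time i) - t| <= e.
Proof.
move=> /andP[t0 t1] e0.
have [m me] : exists m, 2%:R ^- m < e.
  have [m _ H] := near_infty_natSinv_expn_lt (PosNum e0); exists m.
  by have := H m (leqnn m); rewrite /= div1r.
(* The chosen time is the midpoint of a dyadic interval of length [2 ^- m] that contains [t]; the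
   minimum with [2 ^ m - 1] takes care of [t = 1]. *)
pose u := t * 2%:R ^+ m; pose k := minn (Num.truncn u) (2 ^ m - 1).
have p2 : (2 ^ m * 2 = 2 ^ m.+1)%N by rewrite expnSr.
have m0 : (0 < 2 ^ m)%N by rewrite expn_gt0.
exists (CodeSeq.code (m.+1 :: CodeSeq.decode k)).-1; rewrite /time.
rewrite prednK; last by rewrite muln_gt0 expn_gt0.
rewrite hd_code tl_code CodeSeq.decodeK.
have kle : (k <= 2 ^ m - 1)%N by exact: geq_minr.
rewrite ifT; last by rewrite -p2 -muln2; lia.
rewrite /dyadic rmorphM fmorphV rmorphXn /= !ratr_nat.
have M0 : 0 < 2%:R ^+ m :> R by rewrite exprn_gt0.
have u0 : 0 <= u by rewrite mulr_ge0// ltW.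
have uM : u <= 2%:R ^+ m by rewrite ler_piMl// ltW.
have /andP[ku1 ku2] : k%:R <= u <= k%:R + 1.
  have /andP[lo hi] := truncn_itv u0.
  rewrite /k; case: leqP => [_|lt]; first by rewrite lo/= natr1 ltW.
  rewrite natr1 subn1 prednK// natrX uM andbT; apply: le_trans lo.
  by rewrite ler_nat -subn1 ltnW.
have -> : t = u / 2%:R ^+ m by rewrite mulfK// gt_eqF.
apply: le_trans (ltW me); rewrite -[leRHS]mul1r.
rewrite exprS invfM mulrA -mulrBl normrM (gtr0_norm (_ : 0 < _ ^- m)) ?invr_gt0//.
rewrite ler_pM2r ?invr_gt0// -natr1 -muln2 natrM ler_norml.
apply/andP; split; lra.
Qed.
End Times.

Section Samples.
Variables (R : realType) (n : nat) (gamma : R -> 'rV[R]_n).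
Hypothesis gamma_comp : computable_fun gamma.

Definition sample (i : nat) : 'rV[R]_n := gamma (ratr (time i)).

(** A rational time has a constant sequence as an oracle, so [internalize_oracle] turns the oracle
    program into one that takes [pickle (time i)] as an argument. *)
Lemma computable_sample : exists out : nat -> nat -> nat,
  (forall k f h, computable k f -> computable k h ->
     computable k (fun xs => out (f xs) (h xs))) /\
  forall P i, exists v : 'rV[rat]_n, unpickle (out P i) = Some v /\
     enorm (map_mx ratr v - sample i) <= 2%:R ^- P.
Proof.
have [M HM] := gamma_comp.
have H (P i : nat) : exists out, peval (fun=> pickle (time i)) M [:: P] out /\
    exists v : 'rV[rat]_n, unpickle out = Some v /\
      enorm (map_mx ratr v - sample i) <= 2%:R ^- P.
  have Ht : is_oracle (ratr (time i) : R) (fun=> time i).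
    by move=> s; rewrite subrr normr0 invr_ge0 exprn_ge0.
  by have [out [v [H1 H2 H3]]] := HM _ (time01 R i) _ Ht P; exists out; split=> //; exists v.
exists (fun P i => projT1 (cid (H P i))); split; last first.
  by move=> P i; case: cid => out [].
move=> k f h; apply: (comp_subst2 (F := fun P i => projT1 (cid (H P i)))).
have [pt Hpt] := comp_pickle_time (comp_proj 2 1).
exists (PComp (internalize_oracle 1 M) [:: PProj 0; pt]) => -[|P [|i []]]// _.
econstructor.
  constructor; first by constructor.
  by constructor; [exact: Hpt|constructor].
rewrite /=; case: cid => out [Hout _] /=.
exact: (peval_internalize (fun=> 0%N) Hout).
Qed.

Lemma natr_absdiff a b : (absdiff a b)%:R = `|a%:R - b%:R| :> R.
Proof.
rewrite /absdiff; case: (leqP a b) => [ab|/ltnW ab].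
  rewrite (eqP ab) add0n natrB// distrC ger0_norm// subr_ge0 ler_nat//.
by rewrite (eqP ab) addn0 natrB// ger0_norm// subr_ge0 ler_nat.
Qed.

Lemma isqrt_sqrt m : (isqrt m)%:R <= Num.sqrt (m%:R : R) <= (isqrt m)%:R + 1.
Proof.
have /andP[lo hi] := isqrtP m.
rewrite -[X in X <= _](ger0_norm (ler0n _ _)) -sqrtr_sqr ler_wsqrtr /=; last first.
  by rewrite -natrX ler_nat.
rewrite natr1 -[X in _ <= X](ger0_norm (ler0n _ _)) -sqrtr_sqr ler_wsqrtr//.
by rewrite -natrX ler_nat ltnW.
Qed.

(** In units of [2 ^- N], a coordinate is off by at most 2 (1 from the approximation of the sample,
    1 from [row_partP]), a vector by [2 * n], the difference of two vectors by [4 * n], and the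
    integer square root adds 1. Differences of signed coordinates are regrouped as [p + q'] against
    [p' + q] so as to stay within the naturals. *)
Lemma computable_distances : exists D : nat -> nat -> nat -> nat,
  computable 3 (fun xs => D (nth 0 xs 0) (nth 0 xs 1) (nth 0 xs 2))%N /\
  forall N i i', `|(D N i i')%:R - 2%:R ^+ N * enorm (sample i - sample i')|
    <= (4 * n + 1)%N%:R.
Proof.
have [out [out_comp outP]] := computable_sample.
pose p N i j := row_part posz_of_code N (out N i) j.
pose q N i j := row_part negz_of_code N (out N i) j.
exists (fun N i i' => isqrt (\sum_(j < n)
  absdiff (p N i j + q N i' j) (p N i' j + q N i j) ^ 2))%N; split.
  apply: comp_isqrt; apply: (@comp_sum 3 (fun=> n) (fun ys =>
     absdiff (p (nth 0 ys 1) (nth 0 ys 2) (nth 0 ys 0) +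
       q (nth 0 ys 1) (nth 0 ys 3) (nth 0 ys 0))
       (p (nth 0 ys 1) (nth 0 ys 3) (nth 0 ys 0) +
       q (nth 0 ys 1) (nth 0 ys 2) (nth 0 ys 0)) ^ 2)%N).
    exact: comp_const.
  have pc a b c : computable 4 (fun ys => p (nth 0 ys a) (nth 0 ys b) (nth 0 ys c))%N.
    by apply: comp_row_part; [exact: comp_posz| | apply: out_comp|]; exact: comp_proj.
  have qc a b c : computable 4 (fun ys => q (nth 0 ys a) (nth 0 ys b) (nth 0 ys c))%N.
    by apply: comp_row_part; [exact: comp_negz| | apply: out_comp|]; exact: comp_proj.
  by rewrite /absdiff; repeat first [exact: pc | exact: qc | comp_base].
move=> N i i'.
pose w i : 'rV[R]_n := \row_j ((p N i j)%:R - (q N i j)%:R).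
have wP k : enorm (w k - 2%:R ^+ N *: sample k) <= (2 * n)%N%:R.
  apply: le_trans (enorm_le_sum _) _.
  apply: (@le_trans _ _ (\sum_(j < n) 2%:R)); last first.
    by rewrite sumr_const card_ord mulrnA.
  apply: ler_sum => j _; rewrite !mxE.
  have [v [vE vP]] := outP N k.
  have := row_partP N j vE; rewrite -(ler_rat R) ratr_norm !rmorphB rmorphM rmorphXn /=.
  rewrite !ratr_nat rmorph1 -/(p N k j) -/(q N k j).
  have : `|2%:R ^+ N * (ratr (v ord0 j) - sample k ord0 j)| <= 1.
    rewrite normrM ger0_norm ?exprn_ge0//.
    have N0 : 0 < 2%:R ^+ N :> R by rewrite exprn_gt0.
    rewrite -ler_pdivlMl// mulr1; apply: le_trans vP.
    by have := coord_le_enorm (map_mx ratr v - sample k) j; rewrite !mxE.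
  rewrite mulrBr !ler_norml => /andP[h1 h2] /andP[h3 h4].
  by apply/andP; split; lra.
have -> : 2%:R ^+ N * enorm (sample i - sample i') =
    enorm (2%:R ^+ N *: sample i - 2%:R ^+ N *: sample i').
  by rewrite -scalerBr enormZ ger0_norm// exprn_ge0.
set m := (\sum_(j < n) _)%N.
have wm : enorm (w i - w i') = Num.sqrt m%:R.
  rewrite /enorm natr_sum; congr Num.sqrt; apply: eq_bigr => j _.
  by rewrite natrX natr_absdiff real_normK ?num_real// !mxE !natrD; ring.
have /andP[lo hi] := isqrt_sqrt m.
have := ler_dist_enorm (w i - w i') (2%:R ^+ N *: sample i - 2%:R ^+ N *: sample i').
have -> : w i - w i' - (2%:R ^+ N *: sample i - 2%:R ^+ N *: sample i') =
    (w i - 2%:R ^+ N *: sample i) - (w i' - 2%:R ^+ N *: sample i').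
  by apply/rowP => j; rewrite !mxE; ring.
move=> dist.
have := ler_enormD (w i - 2%:R ^+ N *: sample i) (- (w i' - 2%:R ^+ N *: sample i')).
rewrite enormN => tri; have h1 := wP i; have h2 := wP i'.
have : (4 * n + 1)%N%:R = (2 * n)%N%:R + (2 * n)%N%:R + 1 :> R.
  by rewrite -natrD natr1; congr (_%:R); lia.
move: dist; rewrite -wm in lo hi; rewrite !ler_norml => /andP[d1 d2] ->.
by apply/andP; split; lra.
Qed.

End Samples.

Lemma exists_expn_lt (R : realType) (e : R) : 0 < e -> exists m, 2%:R ^- m < e.
Proof.
move=> e0; have [m _ H] := near_infty_natSinv_expn_lt (PosNum e0); exists m.
by have := H m (leqnn m); rewrite /= div1r.
Qed.

Section Density.
Variables (R : realType) (n : nat) (gamma : R -> 'rV[R]_n).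
Hypothesis gamma_comp : computable_fun gamma.

(** Run the program on an oracle for [t]; only its first [B] answers matter. For a time close enough
    to [t], those answers followed by that time form an oracle for it, so the same output
    approximates both values of [gamma]. *)
Lemma sample_dense t e : 0 <= t <= 1 -> 0 < e ->
  exists i, enorm (gamma t - sample gamma i) <= e.
Proof.
move=> t01 e0; have [M HM] := gamma_comp.
have [r re] := exists_expn_lt (divr_gt0 e0 (ltr0Sn R 1)).
(* Answers twice as precise as required leave room for replacing [t] by a nearby time. *)
have Oex s : exists q : rat, `|ratr q - t| <= 2%:R ^- s.+1.
  have p0 : 0 < (2%:R ^- s.+1 : R) by rewrite invr_gt0 exprn_gt0.
  have [|q] := @rat_in_itvoo R (t - 2%:R ^- s.+1) (t + 2%:R ^- s.+1); first by lra.
  rewrite in_itv /= => /andP[q1 q2]; exists q; rewrite ler_norml; apply/andP; split; lra.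
have [Ora HO] := choice Oex.
have half s : 2%:R ^- s.+1 + 2%:R ^- s.+1 = 2%:R ^- s :> R.
  by rewrite exprS invfM -mulrDl -div1r addf_div//=; field.
have pow_gt0 s : 0 < (2%:R ^- s : R) by rewrite invr_gt0 exprn_gt0.
have tO : is_oracle t Ora.
  by move=> s; apply: le_trans (HO s) _; rewrite -(half s) lerDl ltW.
have [out [v [Mo outv vt]]] := HM t t01 Ora tO r.
have [B HB] := finite_use Mo.
have [i ti] := time_dense t01 (pow_gt0 B.+1).
pose Ora' s := if (s < B)%N then Ora s else time i.
have iO : is_oracle (ratr (time i) : R) Ora'.
  move=> s; rewrite /Ora'; case: (ltnP s B) => sB; last by rewrite subrr normr0 ltW.
  have := ler_distD t (ratr (Ora s)) (ratr (time i)).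
  have := HO s; rewrite distrC in ti => h1 h2; apply: le_trans h2 _.
  rewrite -(half s); apply: lerD => //; apply: le_trans ti _; rewrite lef_pV2 ?posrE ?exprn_gt0//.
  by rewrite ler_eXn2l ?ltr1n// ltnS ltnW.
have [out' [v' [Mo' outv' vi]]] := HM _ (time01 R i) Ora' iO r.
have oute : out' = out.
  apply: peval_det Mo' _; apply: HB => s sB.
  by rewrite /Ora' sB.
exists i; apply: le_trans (enorm_triangle (map_mx ratr v) _ _) _.
rewrite enormB; move: outv'; rewrite oute outv => -[vv']; rewrite -vv' in vi.
rewrite /sample; lra.
Qed.

End Density.

(** * One-dimensional Hausdorff measure *)

Section Hausdorff.
Variables (R : realType) (n : nat).
Implicit Types (A U : set 'rV[R]_n).

Lemma diam_ge0 U : (0 <= diam U)%E.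
Proof. by apply: ereal_sup_ubound; right. Qed.

Lemma enorm_le_diam U x y : U x -> U y -> ((enorm (x - y))%:E <= diam U)%E.
Proof. by move=> Ux Uy; apply: ereal_sup_ubound; left; exists x => //; exists y. Qed.

Lemma diam_le U (d : R) : 0 <= d ->
  (forall x y, U x -> U y -> enorm (x - y) <= d) -> (diam U <= d%:E)%E.
Proof.
move=> d0 H; apply: ge_ereal_sup => _ [[x Ux [y Uy <-]]|->]; rewrite lee_fin//.
exact: H.
Qed.

Lemma hausdorff1_delta_mono A (d d' : R) : d <= d' ->
  (hausdorff1_delta d' A <= hausdorff1_delta d A)%E.
Proof.
move=> dd'; apply: le_ereal_inf => _ [U [AU Ud] <-]; exists U => //; split=> // i.
by apply: le_trans (Ud i) _; rewrite lee_fin.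
Qed.

Lemma hausdorff1_delta_le A (d : R) : 0 < d ->
  (hausdorff1_delta d A <= hausdorff1 A)%E.
Proof. by move=> d0; apply: ereal_sup_ubound; exists d. Qed.

Lemma hausdorff1_delta_finite_cover A (d : R) (U : nat -> set 'rV[R]_n) K :
  0 <= d -> A `<=` \bigcup_i U i -> (forall i, (diam (U i) <= d%:E)%E) ->
  (forall i, (K <= i)%N -> U i = set0) ->
  (hausdorff1_delta d A <= (K%:R * d)%:E)%E.
Proof.
move=> d0 AU Ud UK.
apply: (@le_trans _ _ (\sum_(0 <= i <oo) diam (U i))%E).
  by apply: ereal_inf_lbound; exists U.
apply: lime_le; first by apply: is_cvg_nneseries => *; exact: diam_ge0.
apply: nearW => m.
have diamU i : (diam (U i) <= (if (i < K)%N then d else 0)%:E)%E.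
  case: ltnP => iK; first exact: Ud.
  by rewrite UK//; apply: diam_le.
apply: (@le_trans _ _ (\sum_(0 <= i < m) (if (i < K)%N then d else 0)%:E)%E).
  exact: lee_sum.
have -> : (\sum_(0 <= i < m) (if (i < K)%N then d else 0)%:E = ((minn m K)%:R * d)%:E)%E.
  elim: m => [|m IH]; first by rewrite big_geq// min0n mul0r.
  rewrite big_nat_recr//= IH -EFinD; congr EFin.
  have [mK|Km] := ltnP m K.
    by rewrite (minn_idPl mK) -natr1 mulrDl mul1r.
  by rewrite (minn_idPr (leqW Km)) addr0.
by rewrite lee_fin ler_wpM2r// ler_nat geq_minr.
Qed.

Lemma cvg_enormB (T : Type) (F : set_system T) (f g : T -> 'rV[R]_n) (a b : 'rV[R]_n) :
  Filter F -> f @ F --> a -> g @ F --> b ->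
  enorm (f x - g x) @[x --> F] --> enorm (a - b).
Proof.
move=> FF fa gb; apply: (cvg_comp _ _ (cvgB fa gb)); exact: continuous_enorm.
Qed.

(** A sample within [e / 2] of [y] is within [e] of all points near [y]; compactness then bounds the
    indices that are needed. *)
Lemma uniform_net A (x : nat -> 'rV[R]_n) (e : R) : compact A -> 0 < e ->
  (forall y e, A y -> 0 < e -> exists i, enorm (y - x i) <= e) ->
  exists N0, forall N, (N0 <= N)%N -> forall y, A y ->
    exists2 i, (i < N)%N & enorm (y - x i) <= e.
Proof.
move=> cA e0 H.
have /compact_near_coveringP/(_ nat \oo
  (fun N y => exists2 i, (i < N)%N & enorm (y - x i) <= e) _) := cA.
case=> [y Ay|N0 _ HN0]; last by exists N0 => N /HN0; apply.
have e2 : 0 < e / 2 by rewrite divr_gt0.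
have [i yi] := H y (e / 2) Ay e2.
have near_y : \forall y' \near y, enorm (y' - y) < e / 2.
  have c : enorm (y' - y) @[y' --> y] --> enorm (y - y).
    by apply: (@cvg_enormB _ (nbhs y) id (fun=> y) y y); [exact: cvg_id|exact: cvg_cst].
  rewrite subrr enorm0 in c; exact: (@cvgr_lt R _ (nbhs y) _ (fun y' => enorm (y' - y)) 0 c _ e2).
exists ([set y' | enorm (y' - y) < e / 2], [set N | (i < N)%N]) => /=.
  by split=> //; exact: nbhs_infty_gt.
move=> [y' N] /= [yy' iN]; exists i => //.
apply: le_trans (enorm_triangle y _ _) _; rewrite [leRHS](splitr e).
by apply: lerD => //; exact: ltW.
Qed.

Lemma hausdorff1_le_paths A (x : nat -> 'rV[R]_n) (S : R) : compact A -> 0 <= S ->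
  (forall y e, A y -> 0 < e -> exists i, enorm (y - x i) <= e) ->
  (forall e N0, 0 < e -> exists N, (N0 <= N)%N /\ exists sigma : nat -> nat,
    (forall j, (j < N)%N -> exists2 i, (i < N)%N & sigma i = j) /\
    \sum_(i < N.-1) enorm (x (sigma i) - x (sigma i.+1)) <= S + e) ->
  (hausdorff1 A <= S%:E)%E.
Proof.
move=> cA S0 dense paths.
suff Hd (t : R) : 0 < t -> t <= 1 ->
    (hausdorff1_delta (t + 2 * t ^+ 2) A <= ((S + 2 * t) * (1 + 2 * t))%:E)%E.
  apply: ge_ereal_sup => _ [d /= d0 <-]; apply/lee_addgt0Pr => e e0.
  (* As [t <= 1] gives [t ^+ 2 <= t], the diameters are at most [3 * t], whence [d / 3], and the
     excess over [S] is at most [t * (2 * S + 6)]. *)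
  pose t := Num.min 1 (Num.min (d / 3) (e / (2 * S + 6))).
  have S6 : 0 < 2 * S + 6 by lra.
  have t0 : 0 < t by rewrite !lt_min ltr01 !divr_gt0.
  have t1 : t <= 1 by rewrite ge_min lexx.
  have td : t <= d / 3 by rewrite !ge_min lexx orbT.
  have te : t * (2 * S + 6) <= e by rewrite -ler_pdivlMr// !ge_min lexx !orbT.
  have tt : t ^+ 2 <= t by rewrite expr2 ler_piMr// ltW.
  apply: le_trans (hausdorff1_delta_mono A (_ : t + 2 * t ^+ 2 <= d)) _; first by lra.
  apply: le_trans (Hd t t0 t1) _; rewrite -EFinD lee_fin.
  have -> : (S + 2 * t) * (1 + 2 * t) = S + t * (2 * S) + 2 * t + 4 * t ^+ 2 by ring.
  move: te; rewrite mulrDr; lra.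
move=> t0 t1.
have t2 : 0 < t ^+ 2 by rewrite exprn_gt0.
have [N0 net] := uniform_net cA t2 dense.
have [N [N0N [sigma [surj len]]]] := paths t N0 t0.
pose a k := \sum_(i < k) enorm (x (sigma i) - x (sigma i.+1)).
have a0 k : 0 <= a k by apply: sumr_ge0 => i _; exact: enorm_ge0.
have aD k l : (k <= l)%N -> enorm (x (sigma k) - x (sigma l)) <= a l - a k.
  elim: l => [|l IH]; first by rewrite leqn0 => /eqP ->; rewrite !subrr enorm0.
  rewrite leq_eqVlt => /predU1P[->|]; first by rewrite !subrr enorm0.
  rewrite ltnS => /IH kl; rewrite {1}/a big_ord_recr /= -/(a l).
  by have := enorm_triangle (x (sigma l)) (x (sigma k)) (x (sigma l.+1)); lra.
have a_mono k l : (k <= l)%N -> a k <= a l.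
  by move=> /aD kl; rewrite -subr_ge0; apply: le_trans kl; exact: enorm_ge0.
have aS k : (k < N)%N -> a k <= S + t.
  by move=> kN; apply: le_trans len; apply: a_mono; case: (N) kN.
(* Vertices are grouped by their distance from the start measured along the path, in steps of [t];
   two vertices of one block are therefore less than [t] apart. *)
pose blk k := Num.truncn (a k / t).
have blkP k : (blk k)%:R * t <= a k < ((blk k).+1)%:R * t.
  have /andP[lo hi] := truncn_itv (divr_ge0 (a0 k) (ltW t0)).
  by rewrite -ler_pdivlMr// -ltr_pdivrMr// lo hi.
pose U j := [set y | A y /\ exists k, [/\ (k < N)%N, blk k = j & enorm (y - x (sigma k)) <= t ^+ 2]].
pose K := (Num.truncn ((S + t) / t)).+1.
have St : 0 <= (S + t) / t by rewrite divr_ge0 ?ltW//; lra.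
apply: le_trans (_ : ((K%:R * (t + 2 * t ^+ 2))%:E <= _)%E); last first.
  have /andP[lo _] := truncn_itv St.
  have -> : (S + 2 * t) * (1 + 2 * t) = ((S + t) / t + 1) * (t + 2 * t ^+ 2).
    by field; rewrite gt_eqF.
  by rewrite lee_fin; apply: ler_wpM2r; [lra|rewrite /K -natr1; lra].
apply: (@hausdorff1_delta_finite_cover _ _ U).
- lra.
- move=> y Ay; have [i iN yi] := net N N0N y Ay.
  have [k kN ki] := surj i iN.
  by exists (blk k) => //; split=> //; exists k; split=> //; rewrite ki.
- move=> j; apply: diam_le; first by lra.
  have main y z k l : (k <= l)%N -> blk k = j -> blk l = j ->
      enorm (y - x (sigma k)) <= t ^+ 2 -> enorm (z - x (sigma l)) <= t ^+ 2 ->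
      enorm (y - z) <= t + 2 * t ^+ 2.
    move=> kl kj lj yk zl; rewrite enormB in zl.
    have := enorm_triangle (x (sigma k)) y z.
    have := enorm_triangle (x (sigma l)) (x (sigma k)) z.
    have := aD k l kl; have := blkP k; have := blkP l; rewrite kj lj -natr1.
    by move=> /andP[? ?] /andP[? ?]; lra.
  move=> y z [_ [k [_ kj yk]]] [_ [l [_ lj zl]]].
  case: (leqP k l) => kl; first exact: main kl kj lj yk zl.
  by rewrite enormB; exact: main (ltnW kl) lj kj zl yk.
- move=> j Kj; apply/seteqP; split=> // y [_ [k [kN kj _]]].
  move: Kj; rewrite leqNgt /K ltnS -kj => /negP; apply.
  apply: le_truncn; rewrite ler_pM2r ?invr_gt0//; exact: aS.
Qed.

End Hausdorff.

(** * Polygons inscribed in a simple curve *)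

Section SimpleCurve.
Variables (R : realType) (n : nat) (G : set 'rV[R]_n) (g : R -> 'rV[R]_n) (a b : R).
Hypothesis Gg : simple_param G g a b.

(* [g] need not be continuous outside [a, b]; composing with the clamping map
   makes it continuous everywhere without changing it on [a, b]. *)
Definition clamp (t : R) : R := Num.max a (Num.min b t).
Definition gc (t : R) : 'rV[R]_n := g (clamp t).

Lemma clamp_in t : a <= clamp t <= b.
Proof.
have [ab _ _ _] := Gg.
by rewrite /clamp le_max lexx /= ge_max (ltW ab) ge_min lexx.
Qed.

Lemma clamp_id t : a <= t <= b -> clamp t = t.
Proof. by move=> /andP[at_ tb]; rewrite /clamp (min_idPr tb) (max_idPr at_). Qed.

Lemma gc_id t : a <= t <= b -> gc t = g t.
Proof. by move=> tab; rewrite /gc clamp_id. Qed.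

Lemma gcG t : G (gc t).
Proof.
have [_ _ _ <-] := Gg; exists (clamp t) => //=.
by rewrite in_itv /= clamp_in.
Qed.

Lemma continuous_gc : continuous gc.
Proof.
have [ab /subspace_continuousP cg _ _] := Gg.
move=> t; rewrite /gc; apply: (@cvg_trans _ (g @ within `[a, b] (nbhs (clamp t)))); last first.
  by apply: cg; rewrite /= in_itv /= clamp_in.
have cc : {for t, continuous clamp}.
  apply: continuous_max; first exact: cvg_cst.
  by apply: continuous_min; [exact: cvg_cst|exact: cvg_id].
move=> P /= HP; have H := cc _ HP; apply: (@filterS _ (nbhs t) _ _ _ _ H) => x /=; apply.
by rewrite in_itv /= clamp_in.
Qed.

Lemma compact_curve : compact G.
Proof.
have [_ cg _ <-] := Gg.
by apply: continuous_compact => //; exact: segment_compact.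
Qed.

(** By injectivity the distance is positive on the compact set of pairs with [s + eta <= t], hence
    bounded away from 0 there. In the covering argument over the whole square, a pair outside this
    set has a neighborhood on which the premise fails. *)
Lemma separated (eta : R) : 0 < eta -> exists2 d, 0 < d &
  forall s t, a <= s <= b -> a <= t <= b -> s + eta <= t -> d < enorm (g s - g t).
Proof.
move=> eta0; have [ab _ gi _] := Gg.
have cK := compact_setX (@segment_compact R a b) (@segment_compact R a b).
have /compact_near_coveringP/(_ R 0^'+
  (fun d st => st.1 + eta <= st.2 -> d < enorm (gc st.1 - gc st.2)) _) := cK.
case=> [[s t] /= [+ +]|].
  rewrite !in_itv /= => sab tab.
  have [st|st] := ltP t (s + eta).
    have : \forall st' \near (s, t), st'.2 - st'.1 < eta.
      have c : st'.2 - st'.1 @[st' --> (s, t)] --> t - s by apply: cvgB; [exact: cvg_snd|exact: cvg_fst].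
      have ts : t - s < eta by lra.
      exact: (@cvgr_lt R _ (nbhs (s, t)) _ (fun st' => st'.2 - st'.1) (t - s) c _ ts).
    move=> H; exists ([set st' | st'.2 - st'.1 < eta], setT) => /=.
      by split=> //; exact: filterT.
    by move=> [[s' t'] d] /= [h _] h'; lra.
  have m0 : 0 < enorm (gc s - gc t).
    rewrite lt_neqAle enorm_ge0 andbT eq_sym; apply/eqP => /enorm_eq0/eqP.
    rewrite subr_eq0 !gc_id// => /eqP /gi E.
    by move: st; rewrite E ?in_itv//= ; lra.
  have m2 : enorm (gc s - gc t) / 2 < enorm (gc s - gc t) by lra.
  exists ([set st' | enorm (gc s - gc t) / 2 < enorm (gc st'.1 - gc st'.2)], [set d | d < enorm (gc s - gc t) / 2]) => /=.
    split; last by apply: nbhs_right_lt; lra.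
    apply: (@cvgr_gt R _ (nbhs (s, t)) _ (fun st' => enorm (gc st'.1 - gc st'.2)) (enorm (gc s - gc t))) => //.
    apply: cvg_enormB.
      apply: (@cvg_comp _ _ _ fst gc); [exact: cvg_fst|exact: continuous_gc].
    apply: (@cvg_comp _ _ _ snd gc); [exact: cvg_snd|exact: continuous_gc].
  by move=> [[s' t'] d] /= [h1 h2] _; apply: lt_trans h1.
move=> e /= e0 He; exists (e / 2); first by rewrite divr_gt0.
move=> s t sab tab; rewrite -!gc_id//; apply: (He (e / 2) _ _ (s, t)).
- by rewrite /= sub0r normrN gtr0_norm ?divr_gt0//; lra.
- by rewrite divr_gt0.
- by split; rewrite /= in_itv.
Qed.


(** Each condition holds for all small [eta], by continuity of [gc], and there are finitely many of
    them, so one [eta] serves all arcs. The guard [u i < u i.+1] skips degenerate arcs, which occur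
    when samples coincide. *)
Lemma shrink (u : nat -> R) N (e : R) : 0 < e ->
  exists2 eta, 0 < eta & forall i, (i < N)%N -> u i < u i.+1 ->
    [/\ u i + 2 * eta < u i.+1, enorm (gc (u i + eta) - gc (u i)) < e &
        enorm (gc (u i.+1 - eta) - gc (u i.+1)) < e].
Proof.
move=> e0.
have H i : u i < u i.+1 -> \forall eta \near 0^'+,
    [/\ u i + 2 * eta < u i.+1, enorm (gc (u i + eta) - gc (u i)) < e &
        enorm (gc (u i.+1 - eta) - gc (u i.+1)) < e].
  move=> ui.
  have near_gc (f : R -> R) v : f x @[x --> (0 : R)] --> v ->
      \forall eta \near 0^'+, enorm (gc (f eta) - gc v) < e.
    move=> fv.
    have c : enorm (gc (f x) - gc v) @[x --> 0^'+] --> enorm (gc v - gc v).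
      apply: cvg_enormB; last exact: cvg_cst.
      apply: (@cvg_comp _ _ _ f gc); last exact: continuous_gc.
      exact: (cvg_at_right_filter fv).
    rewrite subrr enorm0 in c.
    exact: (@cvgr_lt R _ (0^'+) _ (fun x => enorm (gc (f x) - gc v)) 0 c _ e0).
  have h1 : \forall eta \near 0^'+, eta < (u i.+1 - u i) / 2.
    by apply: nbhs_right_lt; rewrite divr_gt0 ?subr_gt0.


  have h2 : \forall eta \near 0^'+, enorm (gc (u i + eta) - gc (u i)) < e.
    apply: (near_gc (fun x => u i + x) (u i)).
    by rewrite -[X in _ --> X]addr0; apply: cvgD; [exact: cvg_cst|exact: cvg_id].
  have h3 : \forall eta \near 0^'+, enorm (gc (u i.+1 - eta) - gc (u i.+1)) < e.
    apply: (near_gc (fun x => u i.+1 - x) (u i.+1)).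
    by rewrite -[X in _ --> X]subr0; apply: cvgB; [exact: cvg_cst|exact: cvg_id].
  apply: filterS3 h1 h2 h3 => eta h1 h2 h3; split=> //; lra.
have Hn : \forall eta \near 0^'+, forall i, (i < N)%N -> u i < u i.+1 ->
    [/\ u i + 2 * eta < u i.+1, enorm (gc (u i + eta) - gc (u i)) < e &
        enorm (gc (u i.+1 - eta) - gc (u i.+1)) < e].
  elim: N => [|N IH]; first exact: nearW.
  have [uN|uN] := ltP (u N) (u N.+1).
    apply: filterS2 IH (H N uN) => eta h1 h2 i; rewrite ltnS leq_eqVlt.
    by move=> /predU1P[->|/h1].
  apply: filterS IH => eta h1 i; rewrite ltnS leq_eqVlt.
  by move=> /predU1P[->|/h1//]; rewrite ltNge uN.
by have [eta [h1 h2]] := filter_ex (filterI (nbhs_right_gt (0 : R)) Hn); exists eta.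
Qed.

Lemma shrunk_path_le (u : nat -> R) N (eta : R) : 0 < eta ->
  (forall i, a <= u i <= b) -> {homo u : i j / (i <= j)%N >-> i <= j} ->
  (forall i, (i < N)%N -> u i < u i.+1 -> u i + 2 * eta < u i.+1) ->
  ((\sum_(i < N) (if u i < u i.+1
      then enorm (gc (u i.+1 - eta) - gc (u i + eta)) else 0))%:E
    <= hausdorff1 G)%E.
Proof.
move=> eta0 uab umono gap.
have [d d0 sep] := separated eta0.
pose l i := if u i < u i.+1 then enorm (gc (u i.+1 - eta) - gc (u i + eta)) else 0.
pose S k := \sum_(i < k) l i.
have l0 i : 0 <= l i by rewrite /l; case: ifP => // _; exact: enorm_ge0.
have SS k : S k.+1 = S k + l k by rewrite /S big_ord_recr.
have S0 k : 0 <= S k by apply: sumr_ge0 => i _; exact: l0.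
rewrite -[X in (X%:E <= _)%E]/(S N).
apply: le_trans (hausdorff1_delta_le G d0).
apply: le_ereal_inf_tmp => _ [U [GU Ud] <-].
pose dm j := fine (diam (U j)).
have diamE j : diam (U j) = (dm j)%:E.
  rewrite fineK// ge0_fin_numE ?diam_ge0//.
  by apply: le_lt_trans (Ud j) _; rewrite ltry.
have dm0 j : 0 <= dm j by rewrite -lee_fin -diamE diam_ge0.
have dmP j x y : U j x -> U j y -> enorm (x - y) <= dm j.
  by move=> Ux Uy; rewrite -lee_fin -diamE; exact: enorm_le_diam.
have dmd j : dm j <= d by rewrite -lee_fin -diamE.
(* Arc [i] is sent into the line from [S i] on. A set [U j] has diameter at most [d] and so meets
   only one shrunk arc, on which [h i] does not increase distances. *)
pose h i t := S i + enorm (gc t - gc (u i + eta)).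
pose Hs j := [set y | exists i t, [/\ (i < N)%N, u i < u i.+1,
  u i + eta <= t <= u i.+1 - eta, U j (gc t) & y = h i t]].
have far i i' t t' : (i < i')%N -> t <= u i.+1 - eta -> u i' + eta <= t' ->
    u i + eta <= t -> t' <= u i'.+1 - eta -> d < enorm (gc t - gc t').
  move=> ii' ti t'i ti1 t'i1; have := umono _ _ ii' => uu.
  have /andP[u1 u2] := uab i; have /andP[u3 u4] := uab i'.+1.
  have /andP[u5 u6] := uab i.+1; have /andP[u7 u8] := uab i'.
  rewrite !gc_id; [apply: sep| |]; try (apply/andP; split); lra.
have Hs_close j y z : Hs j y -> Hs j z -> y <= z + dm j.
  move=> [i [t [iN ui /andP[t1 t2] Ut ->]]] [i' [t' [i'N ui' /andP[t1' t2'] Ut' ->]]].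
  have [ii'|i'i|E] := ltngtP i i'.
  - have := far _ _ _ _ ii' t2 t1' t1 t2'; have := dmP _ _ _ Ut Ut'; have := dmd j; lra.
  - have := far _ _ _ _ i'i t2' t1 t1' t2; have := dmP _ _ _ Ut' Ut; have := dmd j; lra.
  - rewrite -{i' i'N ui' t1' t2'}E /h.
    have := enorm_triangle (gc t') (gc t) (gc (u i + eta)).
    have := dmP _ _ _ Ut Ut'; lra.
(* The image [Hs j] need not be measurable, so it is enclosed in an interval of length [dm j]. If
   [Hs j] is empty, the default value of [inf] still yields an interval of that length. *)
pose J j : set R := `[inf (Hs j), inf (Hs j) + dm j]%classic.
have HsJ j : Hs j `<=` J j.
  have lb : has_lbound (Hs j).
    by exists 0 => _ [i [t [_ _ _ _ ->]]]; rewrite /h addr_ge0 ?enorm_ge0.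
  move=> y Hy; rewrite /J /= in_itv /= ge_inf//= -lerBlDr.
  apply: lb_le_inf; first by exists y.
  by move=> z Hz; rewrite lerBlDr; exact: Hs_close.
pose I : set R := `[0, S N[%classic.
have cover : I `<=` \bigcup_j J j.
  move=> y; rewrite /I /= in_itv /= => /andP[y0 yS].
  have ex : exists k, y < S k by exists N.
  have [k yk kmin] := ex_minnP ex.
  case: k yk kmin => [|k] yk kmin; first by move: yk; rewrite /S big_ord0; lra.
  have kN : (k < N)%N by exact: kmin.
  have Sky : S k <= y by rewrite leNgt; apply/negP => /kmin; rewrite ltnn.
  have lk : 0 < l k by move: yk; rewrite SS; lra.
  have uk : u k < u k.+1 by move: lk; rewrite /l; case: ifP => //; rewrite ltxx.
  have gk := gap k kN uk.
  have pq : u k + eta <= u k.+1 - eta by lra.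
  have fc : {within `[u k + eta, u k.+1 - eta],
      continuous (fun t => enorm (gc t - gc (u k + eta)))}.
    apply: continuous_subspaceT => t.
    by apply: (@cvg_enormB _ _ _ (nbhs t) gc (fun=> gc (u k + eta)));
      [exact: continuous_gc|exact: cvg_cst].
  (* Along arc [k] the distance to its initial point goes continuously from 0 to [l k], so it
     attains [y - S k]. *)
  have [|t tin ht] := IVT (v := y - S k) pq fc.
    rewrite subrr enorm0; move: yk; rewrite SS /l uk => yk.
    by rewrite minElt maxElt; case: ltP => ?; apply/andP; split; lra.
  rewrite in_itv /= in tin.
  have [j _ Uj] := GU _ (gcG t).
  exists j => //; apply: HsJ; exists k, t; split=> //.
  by rewrite /h ht; lra.
have mJ j : measurable (J j) by exact: measurable_itv.
have : (lebesgue_measure I <=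
    \sum_(0 <= j <oo) lebesgue_measure (J j))%E.
  by apply: measure_sigma_subadditive => //; exact: measurable_itv.
rewrite /I lebesgue_measure_itv /= lte_fin; case: ltP => [SN|SN _]; last first.
  by apply: (@le_trans _ _ 0%E); [rewrite lee_fin|apply: nneseries_ge0 => *; exact: diam_ge0].
rewrite sube0 => /le_trans; apply; apply: lee_nneseries => // j _.
rewrite diamE lebesgue_measure_itv /= lte_fin.
case: ltP => _; last by rewrite lee_fin.
by rewrite -EFinD lee_fin; lra.
Qed.

Lemma path_le_hausdorff1 (u : nat -> R) N :
  (forall i, a <= u i <= b) -> {homo u : i j / (i <= j)%N >-> i <= j} ->
  ((\sum_(i < N) enorm (g (u i) - g (u i.+1)))%:E <= hausdorff1 G)%E.
Proof.
move=> uab umono; apply/lee_addgt0Pr => e e0.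
(* Each of the [N] edges loses at most [2 * e'] by shrinking; [N.+1] avoids a division by 0. *)
pose e' := e / (2 * N.+1%:R).
have e'0 : 0 < e' by rewrite divr_gt0// mulr_gt0.
have [eta eta0 H] := shrink u N e'0.
have gap i : (i < N)%N -> u i < u i.+1 -> u i + 2 * eta < u i.+1.
  by move=> iN /H[].
apply: le_trans (leeD (shrunk_path_le eta0 uab umono gap) (lexx _)).
rewrite -EFinD lee_fin.
apply: (@le_trans _ _ (\sum_(i < N) ((if u i < u i.+1
      then enorm (gc (u i.+1 - eta) - gc (u i + eta)) else 0) + 2 * e'))).
  apply: ler_sum => i _; case: ifPn => ui.
    have [_ h1 h2] := H i (ltn_ord i) ui.
    rewrite -!gc_id//.
    have := enorm_triangle (gc (u i + eta)) (gc (u i)) (gc (u i.+1)).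
    have := enorm_triangle (gc (u i.+1 - eta)) (gc (u i + eta)) (gc (u i.+1)).
    rewrite (enormB (gc (u i)) (gc (u i + eta))) (enormB (gc (u i + eta)) (gc (u i.+1 - eta))).
    lra.
  have -> : u i.+1 = u i by apply: le_anti; rewrite leNgt ui /= umono.
  by rewrite subrr enorm0; lra.
rewrite big_split /= lerD2l sumr_const card_ord -[leLHS]mulr_natl.
have -> : 2 * e' = e / N.+1%:R by rewrite /e'; field; rewrite ?nat1r ?natr1 ?pnatr_eq0.
rewrite mulrA ler_pdivrMr// [leRHS]mulrC; apply: ler_wpM2r; first exact: ltW.
by rewrite ler_nat.
Qed.

End SimpleCurve.

(** Sorting the indices by the parameters of their points under [g] makes the tour an inscribed
    polygon of the simple curve, to which [path_le_hausdorff1] applies. *)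
Lemma ordered_tour (R : realType) (n : nat) (G : set 'rV[R]_n) g a b
    (x : nat -> 'rV[R]_n) N :
  simple_param G g a b -> (forall i, G (x i)) ->
  exists sigma : nat -> nat,
    [/\ forall i, (i < N)%N -> (sigma i < N)%N,
        forall j, (j < N)%N -> exists2 i, (i < N)%N & sigma i = j &
        ((\sum_(i < N.-1) enorm (x (sigma i) - x (sigma i.+1)))%:E
          <= hausdorff1 G)%E].
Proof.
move=> Gg xG; have [ab _ _ gG] := Gg.
have Hs i : exists s, a <= s <= b /\ g s = x i.
  have := xG i; rewrite -gG => -[s /=]; rewrite in_itv /= => sab gs.
  by exists s.
have [s HS] := choice Hs.
pose le_s i j := s i <= s j.
pose order := sort le_s (iota 0 N).
have so : size order = N by rewrite size_sort size_iota.
have mo i : (i \in order) = (i < N)%N by rewrite mem_sort mem_iota add0n.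
have sorted_o : sorted le_s order by apply: sort_sorted => i j; exact: le_total.
pose sigma := nth 0%N order.
have sigN i : (i < N)%N -> (sigma i < N)%N.
  by move=> iN; rewrite -mo mem_nth// so.
exists sigma; split=> //.
  move=> j jN; exists (index j order); last by rewrite /sigma nth_index// mo.
  by rewrite -so index_mem mo.
(* The value [b] past the last sample keeps the sequence monotone and inside [[a, b]] for all
   indices. *)
pose u k := if (k < N)%N then s (sigma k) else b.
have uab k : a <= u k <= b.
  by rewrite /u; case: ifP => _; [case: (HS (sigma k))|rewrite lexx ltW].
have umono : {homo u : k l / (k <= l)%N >-> k <= l}.
  move=> k l kl; rewrite /u.
  have [lN|_] := ltnP l N; last first.
    by case: ifP => // _; case: (HS (sigma k)) => /andP[].
  rewrite (leq_ltn_trans kl lN).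
  apply: (sorted_leq_nth _ _ 0%N sorted_o) => //; rewrite ?inE ?so//.
  - by move=> i j m; exact: le_trans.
  - by move=> i; exact: lexx.
  - exact: leq_ltn_trans kl lN.
rewrite (_ : \sum_(i < N.-1) _ = \sum_(i < N.-1) enorm (g (u i) - g (u i.+1))).
  exact: path_le_hausdorff1 Gg u N.-1 uab umono.
apply: eq_bigr => i _; rewrite /u.
have iN : (i.+1 < N)%N by case: (N) i => [|N'] [].
by rewrite iN (ltnW iN) !(proj2 (HS _)).
Qed.

(** With [N = m + m], one factor [2 ^ m] absorbs the linear growth and the other the constant
    [C / e]. The quantity [2 * (N * c) + 1] bounds the loss in the theorem: [N * c] for replacing
    lengths by [D], [N * c] for the shift in [z], and a half from [q]. *)
Lemma exp2_beats_linear (R : realType) (c : nat) (e : R) N0 : 0 < e ->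
  exists N, [/\ (N0 <= N)%N, (0 < N)%N & (2 * (N * c) + 1)%N%:R <= e * 2%:R ^+ N].
Proof.
move=> e0; pose C : R := (4 * c + 1)%N%:R.
have C0 : 0 < C by rewrite ltr0n addn1.
have [m0 m0e] := exists_expn_lt (divr_gt0 e0 C0).
pose m := (maxn m0 N0).+1.
have m0m : (m0 <= m)%N by rewrite ltnW// ltnS leq_maxl.
exists (m + m)%N; split=> //.
  by apply: leq_trans (leq_addr _ _); rewrite ltnW// ltnS leq_maxr.
have lin : (2 * ((m + m) * c) + 1)%N%:R <= C * 2%:R ^+ m :> R.
  rewrite -natrX -natrM ler_nat; have := ltn_expl m (isT : (1 < 2)%N); nia.
apply: le_trans lin _; rewrite exprD mulrA ler_wpM2r ?exprn_ge0//.
have em : C < e * 2%:R ^+ m0.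
  by move: m0e; rewrite ltr_pdivlMr// mulrC ltr_pdivrMr// exprn_gt0.
apply: le_trans (ltW em) _; rewrite ler_pM2l// ler_eXn2l ?ltr1n//.
Qed.

Theorem theorem4p11 (R : realType) (n : nat) (gamma : R -> 'rV[R]_n) :
  computable_fun gamma ->
  simple_rectifiable_curve (gamma @` `[0, 1]%classic) ->
  lower_semicomputable (hausdorff1 (gamma @` `[0, 1]%classic)).
Proof.
move=> gamma_comp [g [a [b [Gg _]]]]; set G := gamma @` _ in Gg *.
have [D [D_comp D_err]] := computable_distances gamma_comp.
pose c := (4 * n + 1)%N.
(* In units of [2 ^- N] each of the fewer than [N] edges is off by at most [c], so after this shift
   no true minimal length is exceeded. *)
pose z N := (shortest_tour D N - N * c)%N.
(* This is [(z N - 1/2) / 2 ^ N]: giving up half a unit makes the numerator odd, so that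
   [pickle_dyadic] yields the code without any reduction of fractions. *)
pose q N := if z N == 0%N then 0 else dyadic (z N).-1 N.+1.
have pow_gt0 N : 0 < 2%:R ^+ N :> R by rewrite exprn_gt0.
have q0 N : 0 <= q N by rewrite /q; case: ifP => // _; exact: dyadic_ge0.
have qE N : ratr (q N) * 2%:R ^+ N = if z N == 0%N then 0 else (z N)%:R - 2^-1 :> R.
  rewrite /q; case: ifPn => [_|z0]; first by rewrite rmorph0 mul0r.
  rewrite /dyadic rmorphM fmorphV rmorphXn /= !ratr_nat exprS invfM mulrA.
  rewrite mulfVK ?gt_eqF// -[in RHS](prednK (_ : 0 < z N)%N) ?lt0n//.
  by rewrite -muln2 -!natr1 natrM; field.
have xG i : G (sample gamma i).
  by exists (ratr (time i)) => //=; rewrite in_itv /= time01.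
pose len N (sigma : nat -> nat) :=
  \sum_(i < N.-1) enorm (sample gamma (sigma i) - sample gamma (sigma i.+1)).
have lenP N (sigma : nat -> nat) : `|(\sum_(i < N.-1) D N (sigma i) (sigma i.+1))%N%:R
    - 2%:R ^+ N * len N sigma| <= (N * c)%N%:R.
  rewrite natr_sum /len mulr_sumr -sumrB; apply: le_trans (ler_norm_sum _ _ _) _.
  apply: (@le_trans _ _ (\sum_(i < N.-1) c%:R)); first by apply: ler_sum => i _; exact: D_err.
  by rewrite sumr_const card_ord -mulrnA ler_nat mulnC leq_mul2r leq_pred orbT.
have q_le N : ((ratr (q N) : R)%:E <= hausdorff1 G)%E.
  have [sigma [lt surj lenH]] := ordered_tour N Gg xG.
  apply: le_trans lenH; rewrite lee_fin -/(len N sigma).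
  rewrite -(ler_pM2r (pow_gt0 N)) qE.
  have len0 : 0 <= len N sigma by apply: sumr_ge0 => i _; exact: enorm_ge0.
  case: ifPn => [_|z0]; first by rewrite mulr_ge0// ltW.
  have := shortest_tour_le D lt surj; rewrite -(ler_nat R) => h1.
  have : (z N)%:R = (shortest_tour D N)%:R - (N * c)%N%:R :> R.
    by rewrite -natrB// ltnW// -subn_gt0 lt0n.
  have := lenP N sigma; rewrite ler_norml => /andP[h2 h3] ->.
  by rewrite mulrC; lra.
exists q; split; [|split=> //].
  have Hq : computable 1 (fun xs => pickle (q (nth 0%N xs 0))).
    apply: (@comp_ext _ (fun xs => if z (nth 0%N xs 0) == 0%N then pickle (0 : rat)
        else dyadic_code (z (nth 0%N xs 0) - 1) (nth 0%N xs 0).+1)).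
      have Hz : computable 1 (fun xs => z (nth 0%N xs 0)).
        apply: comp_sub; last by repeat comp_base.
        by apply: comp_shortest_tour => //; exact: comp_proj.
      by repeat comp_base; apply: comp_dyadic_code; repeat comp_base.
    by move=> xs _; rewrite /q subn1; case: ifP => // _; rewrite pickle_dyadic.
  by have [p Hp] := Hq; exists p => r; exact: (Hp [:: r]).
apply/eqP; rewrite eq_le; apply/andP; split.
  by apply: ge_ereal_sup => _ [N _ <-]; exact: q_le.
have q_sup N : ((ratr (q N) : R)%:E <= ereal_sup (range (fun r => (ratr (q r) : R)%:E)))%E.
  by apply: ereal_sup_ubound; exists N.
case: (ereal_sup _) q_sup => [S||] q_sup; [|exact: leey|].
  apply: (@hausdorff1_le_paths _ _ _ (sample gamma)).
  - exact: compact_curve Gg.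
  - by have := q_sup 0%N; rewrite lee_fin; apply: le_trans; rewrite ler0q.
  - move=> _ e [t /= t01 <-] e0; exact: sample_dense.
  move=> e N0 e0; have [N [N0N N1 Ne]] := exp2_beats_linear c N0 e0.
  exists N; split=> //.
  have [sigma [lt surj le]] := shortest_tour_attained D N1.
  exists sigma; split=> //; rewrite -/(len N sigma).
  rewrite -(ler_pM2l (pow_gt0 N)).
  have := lenP N sigma; rewrite ler_norml => /andP[h2 h3].
  move: le; rewrite -(ler_nat R) => le.
  have zN : (shortest_tour D N)%:R <= (z N)%:R + (N * c)%N%:R :> R.
    by rewrite -natrD ler_nat /z; lia.
  have zq : (z N)%:R - 2^-1 <= ratr (q N) * 2%:R ^+ N :> R.
    rewrite qE; case: eqP => [->|//]; lra.
  have qS : ratr (q N) * 2%:R ^+ N <= S * 2%:R ^+ N.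
    by rewrite ler_pM2r// -lee_fin.
  move: Ne; rewrite natrD natrM mulrDr (mulrC _ S) (mulrC _ e); lra.
by have := q_sup 0%N; rewrite leeNy_eq.
Qed.
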